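(* For every $\gamma\in(0,1)$ there exists $\epsilon=\epsilon(\gamma)>0$ such that the following holds. Let $p$ be a sufficiently large prime, let $P=A\times B\subseteq(\mathbb{F}_p^2\times\mathbb{F}_p^2)\setminus\{(0,0,0,0)\}$, and let $S$ be a symmetric subset of $SL_2(\mathbb{F}_p)$ with $p^\gamma<|S|<p^{3-2\gamma}$ and $|S\cap gH|<p^{-\gamma/2}|S|$ for every proper subgroup $H\subsetneq SL_2(\mathbb{F}_p)$ and every $g\in SL_2(\mathbb{F}_p)$. Assume every line through the origin contains at most $k$ points of $B$. Then (1) if $|B|<k^{1/2}p$, \[I(P,S)\lesssim k^{1/2}|A|^{1/2}|S|+k^{1/4}p^{\frac{1-\epsilon}{4}}|A|^{1/2}|B|^{1/2}|S|^{3/4};\] (2) if $|B|\ge k^{1/2}p$, \[I(P,S)\lesssim\frac{|A|^{1/2}|B||S|^{3/4}}{p^{\frac{1+\epsilon}{4}}}.\]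
   Context: $S$ symmetric means $S=S^{-1}$. $I(P,S)$ is the number of pairs $((x,y),\theta)\in P\times S$ with $\theta y=x$ (matrices acting on column vectors). A line through the origin is a one-dimensional subspace of $\mathbb{F}_p^2$. $X\lesssim Y$ means $X\le C\log_2 p\cdot Y$ for a constant $C$ independent of $p,A,B,S,k$. *)

(* Defs.v *)
From HB Require Import structures.
From mathcomp Require Import all_boot all_order all_fingroup all_algebra.
From mathcomp Require Import reals exp.

Set Implicit Arguments.
Unset Strict Implicit.
Unset Printing Implicit Defensive.

Import Order.TTheory GRing.Theory Num.Theory.

Local Open Scope ring_scope.

Definition SL2 (p : nat) : {set {'GL_2['F_p]}} :=
  [set g : {'GL_2['F_p]} | \det (GLval g) == 1].

Lemma SL2_group_set (p : nat) : group_set (SL2 p).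
Proof.
apply/group_setP; split=> [|g h]; first by rewrite inE GL_1E det1.
by rewrite !inE GL_ME => /eqP dg /eqP dh; rewrite -mulmxE det_mulmx dg dh mulr1.
Qed.

Canonical SL2_group (p : nat) : {group {'GL_2['F_p]}} := Group (SL2_group_set p).

(* q ranges over the triples ((x, y), theta), incident when theta y = x. *)
Definition incidences (p : nat) (P : {set 'cV['F_p]_2 * 'cV['F_p]_2})
    (S : {set {'GL_2['F_p]}}) : nat :=
  #|[set q in setX P S | GLval q.2 *m q.1.2 == q.1.1]|.

Definition line_bound (p : nat) (B : {set 'cV['F_p]_2}) (k : nat) : Prop :=
  forall L : {vspace 'cV['F_p]_2}, \dim L = 1%N ->
    (#|[set y in B | y \in L]| <= k)%N.

(* The relation X <= C log_2(p) Y, with the implied constant C explicit so that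
   it can be quantified before p. *)
Definition lesssim (R : realType) (C : R) (p : nat) (X Y : R) : Prop :=
  X <= C * (ln p%:R / ln 2) * Y.

(* Main.v *)
(* By Cauchy-Schwarz, I^2 <= |A| J with J the sum over g of r(g) |B :&: g^-1 B|,
   where r(g) is the number of ways to write g = s s'^-1 in S.  Discarding the g
   with |B :&: g^-1 B| <= 2k, a second Cauchy-Schwarz bounds J by the energy of S
   and the number of solutions of det(a, b) = det(c, d) in B, since an element of
   SL2 is determined by its action on two independent vectors.  The determinant
   equation is handled by a variance computation averaged over the dilates of B.

   The energy of S is at most |S|^3 p^-eps: otherwise the noncommutative
   Balog-Szemeredi-Gowers argument yields an approximate group D with a large
   piece of S in a coset of it.  If D generates a proper subgroup this contradicts
   the hypothesis on cosets.  If D generates SL2, then a Larsen-Pink estimate for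
   the trace slices of D makes the intersection of D^2 with one maximal torus
   large, the pivoting argument propagates this to all conjugate tori, and
   counting D^2 along these tori shows that D has size about 1 or about p^3. *)

Require Import Defs.
From HB Require Import structures.
From mathcomp Require Import all_boot all_order all_fingroup all_algebra.
From mathcomp Require Import reals exp.
From mathcomp Require Import zify ring lra.

Set Implicit Arguments.
Unset Strict Implicit.
Unset Printing Implicit Defensive.

Import Order.TTheory GRing.Theory Num.Theory.

(** * Counting and the Balog-Szemeredi-Gowers theorem *)

Lemma sum_mul_sqr_le (I : finType) (P : pred I) (f g : I -> nat) :
  (\sum_(i | P i) f i * g i) ^ 2 <= (\sum_(i | P i) f i ^ 2) * (\sum_(i | P i) g i ^ 2).
Proof.
set Q := _ * _; rewrite -(leq_pmul2l (isT : 0 < 2)).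
have -> : 2 * Q = \sum_(i | P i) \sum_(j | P j) ((f i * g j) ^ 2 + (f j * g i) ^ 2).
  have e : Q = \sum_(i | P i) \sum_(j | P j) (f i * g j) ^ 2.
    rewrite /Q big_distrl; apply: eq_bigr => i _ /=.
    by rewrite big_distrr; apply: eq_bigr => j _ /=; rewrite expnMn.
  under [RHS]eq_bigr => i _ do rewrite big_split.
  by rewrite big_split /= -e exchange_big /= -e mul2n addnn.
rewrite -mulnn big_distrl /= big_distrr /=; apply: leq_sum => i _.
rewrite !big_distrr /=; apply: leq_sum => j _.
by case: (nat_Cauchy (f i * g j) (f j * g i)) => h _; move: h; lia.
Qed.

Lemma sum_sqr_le (I : finType) (P : pred I) (f : I -> nat) :
  (\sum_(i | P i) f i) ^ 2 <= #|P| * \sum_(i | P i) f i ^ 2.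
Proof.
have := sum_mul_sqr_le P (fun=> 1) f; rewrite sum_nat_const muln1.
by rewrite (eq_bigr f) // => i _; rewrite mul1n.
Qed.

Lemma card_sum_bool (T : finType) (A : {set T}) (P : pred T) :
  #|[set x in A | P x]| = \sum_(x in A) P x.
Proof.
by rewrite -sum1dep_card big_mkcondr; apply: eq_bigr => x _; case: (P x).
Qed.

Lemma leq_sum_subset (I : finType) (P Q : pred I) (f : I -> nat) :
  {subset P <= Q} -> \sum_(i | P i) f i <= \sum_(i | Q i) f i.
Proof.
move=> sPQ; rewrite [X in _ <= X](bigID P) /=.
apply: (leq_trans _ (leq_addr _ _)); rewrite big_mkcond [X in _ <= X]big_mkcond.
by apply: leq_sum => i _; have := sPQ i; rewrite /in_mem /=; case: (P i) => // ->.
Qed.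

Lemma sum_setId (T : finType) (A : {set T}) (P : pred T) (F : T -> nat) :
  \sum_(x in [set x in A | P x]) F x = \sum_(x in A) P x * F x.
Proof.
transitivity (\sum_(x in A | P x) F x); first by apply: eq_bigl => x; rewrite inE.
by rewrite big_mkcondr; apply: eq_bigr => x _; case: (P x); rewrite ?mul1n.
Qed.

(* Gowers' argument: a random neighbourhood contains few pairs of small codegree. *)
Lemma many_four_paths (T : finType) (S : {set T}) (G : rel T) (L : nat) :
  #|S| ^ 2 <= L * \sum_(a in S) \sum_(b in S) G a b ->
  exists A : {set T}, [/\ A \subset S, #|S| <= 4 * L * #|A| &
    forall a a', a \in A -> a' \in A ->
      #|S| ^ 2 * #|A| <= 512 * L ^ 4 *
       \sum_(c in S) \sum_(b in S) \sum_(b' in S) [&& G a b, G c b, G c b' & G a' b']].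
Proof.
set s := #|S|; set e := (\sum_(a in S) _) => hE.
case: (posnP s) => [s0|s0].
  by exists set0; split; rewrite ?sub0set ?s0 // => a a'; rewrite inE.
have L0 : 0 < L by case: (L) hE => //; rewrite mul0n leqNgt expn_gt0 s0.
pose N b := [set a in S | G a b].
pose cd a a' := \sum_(b in S) (G a b && G a' b).
pose bad a a' := 16 * L ^ 2 * cd a a' < s.
pose nb b := \sum_(a in N b) \sum_(a' in N b) bad a a'.
have cdC a a' : cd a a' = cd a' a by apply: eq_bigr => b _; rewrite andbC.
have badC a a' : bad a a' = bad a' a by rewrite /bad cdC.
have sN : \sum_(b in S) #|N b| = e.
  rewrite /e exchange_big; apply: eq_bigr => b _ /=.
  by rewrite card_sum_bool.
have sN2 : s ^ 3 <= L ^ 2 * \sum_(b in S) #|N b| ^ 2.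
  have := sum_sqr_le (mem S) (fun b => #|N b|); rewrite sN -/s => h.
  rewrite -(leq_pmul2l s0); apply: leq_trans (_ : L ^ 2 * e ^ 2 <= _); last first.
    by rewrite mulnCA leq_mul2l h orbT.
  by rewrite -expnS -expnMn (expnM s 2 2) leq_exp2r.
have snb : 16 * L ^ 2 * \sum_(b in S) nb b <= s ^ 3.
  have -> : \sum_(b in S) nb b = \sum_(a in S) \sum_(a' in S) bad a a' * cd a a'.
    transitivity (\sum_(b in S) \sum_(a in S) \sum_(a' in S) bad a a' * (G a b && G a' b)).
      apply: eq_bigr => b _; rewrite /nb sum_setId; apply: eq_bigr => a _.
      rewrite sum_setId big_distrr; apply: eq_bigr => a' _ /=.
      by case: (G a b); case: (G a' b); rewrite /= ?muln1 ?mul1n ?muln0.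
    rewrite exchange_big; apply: eq_bigr => a _ /=.
    by rewrite exchange_big; apply: eq_bigr => a' _ /=; rewrite -big_distrr.
  rewrite big_distrr /=; apply: leq_trans (_ : \sum_(a in S) s ^ 2 <= _); last first.
    by rewrite sum_nat_const -/s -expnS.
  apply: leq_sum => a _; rewrite big_distrr /=.
  apply: leq_trans (_ : \sum_(a in S) s <= _); last by rewrite sum_nat_const -/s mulnn.
  by apply: leq_sum => a' _; rewrite /bad; case: ltnP => h; rewrite ?mul1n ?mul0n ?muln0 // ltnW.
have [b bS hb] : exists2 b, b \in S & s ^ 2 + 16 * L ^ 2 * nb b <= 2 * L ^ 2 * #|N b| ^ 2.
  apply/exists_inP; rewrite -[X in is_true X]negbK negb_exists_in; apply/negP => /forall_inP h.
  have : \sum_(b in S) 2 * L ^ 2 * #|N b| ^ 2 < \sum_(b in S) (s ^ 2 + 16 * L ^ 2 * nb b).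
    have [b0 b0S] : exists b, b \in S by apply/card_gt0P.
    rewrite (bigD1 b0) // [X in _ < X](bigD1 b0) //= -addSn leq_add //.
      by rewrite ltnNge h.
    by apply: leq_sum => b /andP[bS _]; apply: ltnW; rewrite ltnNge h.
  rewrite big_split /= sum_nat_const -!big_distrr /= -/s -expnS; lia.
pose A := [set a in N b | 4 * \sum_(a' in N b) bad a a' <= #|N b|].
have sAN : A \subset N b by apply/subsetP => x; rewrite inE => /andP[].
have sNS : N b \subset S by apply/subsetP => x; rewrite inE => /andP[].
set n := #|N b| in hb *.
have hn : s <= 2 * L * n.
  rewrite -(@leq_exp2r _ _ 2) //.
  apply: leq_trans (_ : 2 * L ^ 2 * n ^ 2 <= _); first by lia.
  by rewrite !expnMn; lia.
have hnb : 8 * nb b <= n ^ 2 by rewrite -(@leq_pmul2l (2 * L ^ 2)) ?muln_gt0 ?expn_gt0 ?L0 //; lia.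
have hA : n <= 2 * #|A|.
  have h1 : (n - #|A|) * n <= 4 * nb b.
    rewrite -(cardsDS sAN) -sum_nat_const /nb big_distrr /=.
    apply: leq_trans (_ : \sum_(a in N b :\: A) (4 * \sum_(a' in N b) bad a a') <= _).
      apply: leq_sum => a; rewrite !inE => /andP[h aN].
      by move: h; rewrite aN /= -ltnNge => /ltnW.
    by apply: leq_sum_subset => a; rewrite !inE => /andP[].
  case: (posnP n) => [->//|n0].
  by rewrite -(leq_pmul2r n0); move: h1 hnb; rewrite mulnBl -mulnn; lia.
exists A; split; first exact: subset_trans sAN sNS.
  by apply: leq_trans hn _; rewrite (_ : 4 * L * _ = 2 * L * (2 * #|A|)) ?leq_mul2l ?hA ?orbT //; lia.
move=> a a' aA a'A.
pose C := [set c in N b | ~~ bad a c && ~~ bad a' c].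
have hC : n <= 2 * #|C|.
  have : n <= #|C| + \sum_(c in N b) bad a c + \sum_(c in N b) bad a' c.
    rewrite card_sum_bool -!big_split /= /n -sum1_card; apply: leq_sum => c _.
    by case: (bad a c); case: (bad a' c).
  by move: aA a'A; rewrite !inE => /andP[_ h1] /andP[_ h2]; lia.
have sCS : C \subset S by apply: subset_trans sNS; apply/subsetP => x; rewrite inE => /andP[].
have -> : \sum_(c in S) \sum_(b in S) \sum_(b' in S) [&& G a b, G c b, G c b' & G a' b']
   = \sum_(c in S) cd a c * cd a' c.
  apply: eq_bigr => c _; rewrite /cd big_distrl /=; apply: eq_bigr => b1 _.
  rewrite big_distrr /=; apply: eq_bigr => b2 _.
  by case: (G a b1); case: (G c b1); case: (G c b2); case: (G a' b2).
apply: leq_trans (_ : 512 * L ^ 4 * \sum_(c in C) cd a c * cd a' c <= _); last first.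
  by rewrite leq_mul2l; apply/orP; right; apply: leq_sum_subset; apply/subsetP.
apply: leq_trans (_ : 2 * #|C| * s ^ 2 <= _).
  rewrite mulnC leq_mul2r; apply/orP; right; apply: leq_trans hC.
  exact: subset_leq_card sAN.
rewrite mulnAC mulnC -sum_nat_const big_distrr /=.
apply: leq_sum => c; rewrite !inE /bad -!leqNgt => /and3P[_ h1 h2].
by have := leq_mul h1 h2; lia.
Qed.

(* The number of pairs (a, b) in S * S with a b^-1 = x. *)
Definition rep (gT : finGroupType) (S : {set gT}) (x : gT) : nat := #|S :&: (x *: S)%g|.

Definition energy (gT : finGroupType) (S : {set gT}) : nat := \sum_x rep S x ^ 2.

Definition popular (gT : finGroupType) (S : {set gT}) (L : nat) : {set gT} :=
  [set x | #|S| <= L * rep S x].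

Section Rep.
Variable gT : finGroupType.
Implicit Types (S A D Z : {set gT}) (x : gT).

Lemma repE S x : rep S x = \sum_(a in S) ((x^-1 * a)%g \in S).
Proof.
rewrite -(card_sum_bool S (fun a => (x^-1 * a)%g \in S)); congr #|pred_of_set _|.
by apply/setP => a; rewrite in_setI mem_lcoset inE.
Qed.

Lemma rep_le S x : rep S x <= #|S|.
Proof. exact: subset_leq_card (subsetIl _ _). Qed.

Lemma repV S x : rep S (x^-1)%g = rep S x.
Proof.
rewrite /rep -(card_lcoset (S :&: (x^-1 *: S)%g) x).
congr #|pred_of_set _|; apply/setP => a.
by rewrite mem_lcoset !in_setI !mem_lcoset invgK mulKVg andbC.
Qed.

Lemma rep1 S : rep S 1%g = #|S|.
Proof. by rewrite /rep mul1g setIid. Qed.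

Lemma sum_rep S (F : gT -> nat) :
  \sum_(a in S) \sum_(b in S) F (a * b^-1)%g = \sum_x rep S x * F x.
Proof.
transitivity (\sum_x \sum_(a in S) ((x^-1 * a)%g \in S) * F x); last first.
  by apply: eq_bigr => x _; rewrite repE big_distrl.
rewrite [RHS]exchange_big; apply: eq_bigr => a aS /=.
rewrite (reindex (fun x => (x^-1 * a)%g)) /=.
  rewrite big_mkcond; apply: eq_bigr => x _ /=.
  by rewrite invMg invgK mulKVg; case: (_ \in S); rewrite ?mul1n.
exists (fun b => (a * b^-1)%g) => b _; first by rewrite invMg invgK mulKVg.
by rewrite invMg invgK mulgKV.
Qed.

Lemma sum_rep1 S : \sum_x rep S x = #|S| ^ 2.
Proof.
transitivity (\sum_x rep S x * 1); first by apply: eq_bigr => x _; rewrite muln1.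
by rewrite -(sum_rep S (fun=> 1)) !sum_nat_const muln1 mulnn.
Qed.

Lemma popular_mass S K : #|S| ^ 3 <= K * energy S ->
  #|S| ^ 2 <= 2 * K * \sum_(x in popular S (2 * K)) rep S x.
Proof.
set s := #|S| => h; case: (posnP s) => [->//|s0].
rewrite -(leq_pmul2l s0).
have e1 : \sum_(x in popular S (2 * K)) rep S x ^ 2 <= s * \sum_(x in popular S (2 * K)) rep S x.
  by rewrite big_distrr; apply: leq_sum => x _ /=; rewrite -mulnn leq_mul2r rep_le orbT.
have e2 : 2 * K * \sum_(x | x \notin popular S (2 * K)) rep S x ^ 2 <= s ^ 3.
  rewrite expnS -{2}/s -(sum_rep1 S) !big_distrr /=.
  apply: leq_trans (_ : \sum_(x | x \notin popular S (2 * K)) s * rep S x <= _).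
    apply: leq_sum => x; rewrite inE -ltnNge => /ltnW hx.
    by rewrite -mulnn mulnA leq_mul2r hx orbT.
  exact: leq_sum_subset.
have e3 : energy S = \sum_(x in popular S (2 * K)) rep S x ^ 2 +
    \sum_(x | x \notin popular S (2 * K)) rep S x ^ 2.
  by rewrite /energy (bigID (mem (popular S (2 * K)))).
move: (leq_mul (leqnn (2 * K)) e1) h e2; rewrite {}e3 -/s.
set a := (\sum_(x in _) rep S x ^ 2); set m := (\sum_(x in _) rep S x).
by set b := (bigop _ _ _); lia.
Qed.

Lemma card_popular_le S L : 0 < #|S| -> #|popular S L| <= L * #|S|.
Proof.
move=> s0; rewrite -(leq_pmul2r s0) -sum_nat_const -mulnA mulnn -sum_rep1 big_distrr /=.
apply: leq_trans (_ : \sum_(x in popular S L) L * rep S x <= _); last exact: leq_sum_subset.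
by apply: leq_sum => x; rewrite inE.
Qed.

(* a a'^-1 = (a b^-1) (c b^-1)^-1 (c b'^-1) (a' b'^-1)^-1, with four popular factors. *)
Lemma bsg S K : 1 < K -> 0 < #|S| -> #|S| ^ 3 <= K * energy S ->
  exists A, [/\ A \subset S, #|S| <= K ^ 4 * #|A| &
    #|(A * A^-1)%g| <= K ^ 33 * #|A|].
Proof.
move=> K1 s0 /popular_mass; set D := popular S (2 * K); set s := #|S| in s0 *.
pose G a b := (a * b^-1)%g \in D.
rewrite big_mkcond /= => hD.
have {hD} : s ^ 2 <= 2 * K * \sum_(a in S) \sum_(b in S) G a b.
  rewrite (sum_rep S (fun x => x \in D)).
  apply: leq_trans hD _; rewrite leq_mul2l; apply/orP; right.
  by apply: leq_sum => x _; case: (x \in D); rewrite ?muln1.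
case/many_four_paths => A [AS hA hp]; exists A; split=> //.
  apply: leq_trans hA _; rewrite leq_mul2r (mulnA 4 2) expnSr leq_mul2r.
  by rewrite (@leq_exp2r 2 _ 3) // K1 !orbT.
rewrite -/s in hA hp.
have A0 : 0 < #|A| by case: (posnP #|A|) hA => // ->; rewrite muln0 leqNgt s0.
have K0 : 0 < K by case: (K) hA => //; rewrite !muln0 mul0n leqNgt s0.
have main : #|(A * A^-1)%g| * (s ^ 2 * #|A|) <= 512 * (2 * K) ^ 4 * #|D| ^ 4.
  rewrite -sum_nat_const.
  pose W z := [set w : gT * gT * (gT * gT) | [&& w.1.1 \in D, w.1.2 \in D,
     w.2.1 \in D, w.2.2 \in D & (w.1.1 * w.1.2^-1 * w.2.1 * w.2.2^-1)%g == z]].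
  apply: leq_trans (_ : \sum_(z in (A * A^-1)%g) 512 * (2 * K) ^ 4 * #|W z| <= _).
    apply: leq_sum => z /mulsgP[a a'' aA]; rewrite mem_invg.
    have [a' ->] : exists a', a'' = (a'^-1)%g by exists (a''^-1)%g; rewrite invgK.
    rewrite invgK => aA' ->; apply: leq_trans (hp a a' aA aA') _.
    rewrite leq_mul2l; apply/orP; right.
    pose T := [set q : gT * gT * gT | [&& q.1.1 \in S, q.1.2 \in S, q.2 \in S &
       [&& G a q.1.2, G q.1.1 q.1.2, G q.1.1 q.2 & G a' q.2]]].
    have -> : \sum_(c in S) \sum_(b in S) \sum_(b' in S)
        [&& G a b, G c b, G c b' & G a' b'] = #|T|.
      rewrite -sum1_card pair_big /= pair_big /= big_mkcond [RHS]big_mkcond /=.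
      apply: eq_bigr => -[[c b] b'] _ /=; rewrite inE /=.
      by case: (c \in S); case: (b \in S); case: (b' \in S) => //=; case: [&& _, _, _ & _].
    pose f (q : gT * gT * gT) := ((a * q.1.2^-1, q.1.1 * q.1.2^-1), (q.1.1 * q.2^-1, a' * q.2^-1))%g.
    have fI : injective f.
      move=> [[c b] b'] [[c1 b1] b1'] [] /= /mulgI/invg_inj -> /mulIg ->.
      by move=> /mulgI/invg_inj ->.
    rewrite -(card_imset _ fI); apply/subset_leq_card/subsetP => w /imsetP[[[c b] b']].
    rewrite in_set => /and4P[_ _ _ /and4P[h1 h2 h3 h4]] ->; rewrite in_set.
    apply/and5P; split=> //=; apply/eqP; rewrite !invMg !invgK !mulgA.
    by rewrite !(mulgKV, mulgK).
  rewrite -big_distrr leq_mul2l; apply/orP; right => /=.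
  pose DD := setX (setX D D) (setX D D).
  have -> : #|D| ^ 4 = #|DD| by rewrite !cardsX; lia.
  rewrite (eq_bigr (fun z => \sum_(w in DD) ((w.1.1 * w.1.2^-1 * w.2.1 * w.2.2^-1)%g == z))).
    rewrite exchange_big /= -sum1_card; apply: leq_sum => w _.
    rewrite big_mkcond (bigD1 (w.1.1 * w.1.2^-1 * w.2.1 * w.2.2^-1)%g) //= eqxx.
    rewrite big1 => [|z /negbTE]; first by case: ifP.
    by rewrite eq_sym => ->; case: ifP.
  move=> z _; rewrite -card_sum_bool; congr #|pred_of_set _|; apply/setP => w.
  by rewrite !inE -!andbA.
have hD4 : #|D| ^ 4 <= (2 * K * s) ^ 4 by rewrite leq_exp2r // card_popular_le.
have s20 : 0 < s ^ 2 by rewrite expn_gt0 s0.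
have h9 : 512 <= K ^ 9 by rewrite (@leq_exp2r 2 _ 9).
have hA2 : s ^ 2 <= (4 * (2 * K) * #|A|) ^ 2 by rewrite leq_exp2r.
have h6 : (4 * (2 * K)) ^ 2 <= K ^ 8.
  by rewrite (expnM K 4 2) leq_exp2r // (mulnA 4 2) expnSr leq_mul2r (@leq_exp2r 2 _ 3) // K1 orbT.
have h2K : (2 * K) ^ 4 <= K ^ 8 by rewrite (expnM K 2 4) leq_exp2r // -mulnn leq_mul2r K1 orbT.
have h3 : #|(A * A^-1)%g| * #|A| <= K ^ 25 * s ^ 2.
  rewrite -(leq_pmul2r s20).
  apply: leq_trans (_ : 512 * ((2 * K) ^ 4 * ((2 * K) ^ 4 * s ^ 4)) <= _).
    rewrite -expnMn mulnA; apply: leq_trans (leq_mul (leqnn _) hD4).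
    by apply: leq_trans main; rewrite -mulnA [_ * s ^ 2]mulnC leqnn.
  rewrite -mulnA -expnD mulnA mulnA leq_mul2r; apply/orP; right.
  rewrite (_ : 25 = 9 + (8 + 8)) // expnD -mulnA leq_mul // expnD.
  by rewrite leq_mul.
rewrite -(leq_pmul2r A0); apply: leq_trans h3 _.
apply: leq_trans (leq_mul (leqnn _) hA2) _.
rewrite expnMn -[#|A| ^ 2]mulnn 2!mulnA leq_mul2r leq_mul2r.
apply/orP; right; apply/orP; right.
by rewrite [K ^ 33](expnD K 25 8) leq_mul2l h6 orbT.
Qed.

End Rep.

Lemma leq_avg (T : finType) (S : {set T}) (f : T -> nat) c :
  0 < #|S| -> #|S| * c <= \sum_(a in S) f a -> exists2 a, a \in S & c <= f a.
Proof.
move=> S0 h; apply/exists_inP; move: h; apply: contraLR.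
rewrite negb_exists_in -ltnNge => /forall_inP h.
have : \sum_(a in S) (f a).+1 <= #|S| * c.
  by rewrite -sum_nat_const; apply: leq_sum => a /h; rewrite -ltnNge.
under eq_bigr => a _ do rewrite -addn1.
by rewrite big_split /= sum1_card; lia.
Qed.

Section Approx.
Variable gT : finGroupType.
Implicit Types (S A D Z : {set gT}) (x : gT).

Lemma sum_invg A (F : gT -> nat) : \sum_(a in (A^-1)%g) F a = \sum_(a in A) F (a^-1)%g.
Proof.
rewrite (reindex_inj invg_inj) /=; apply: eq_bigl => a.
by rewrite mem_invg invgK.
Qed.

Lemma energyE S : energy S =
  \sum_(a in S) \sum_(b in S) \sum_(c in S) ((b * a^-1 * c)%g \in S).
Proof.
transitivity (\sum_x rep S x * rep S x); first by apply: eq_bigr => x _; rewrite mulnn.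
rewrite -sum_rep; apply: eq_bigr => a _; apply: eq_bigr => b _; rewrite repE.
by apply: eq_bigr => c _; rewrite invMg invgK.
Qed.

Lemma energyV S : energy (S^-1)%g = energy S.
Proof.
rewrite !energyE sum_invg; apply: eq_bigr => a _.
under eq_bigr => b _ do rewrite sum_invg.
rewrite sum_invg exchange_big; apply: eq_bigr => b _; apply: eq_bigr => c _.
by rewrite mem_invg !invMg !invgK mulgA.
Qed.

Lemma energy_lower A : #|A| ^ 4 <= #|(A * A^-1)%g| * energy A.
Proof.
have -> : #|A| ^ 4 = (\sum_(x in (A * A^-1)%g) rep A x) ^ 2.
  rewrite (expnM _ 2 2); congr (_ ^ 2); rewrite -sum_rep1 (bigID (mem (A * A^-1)%g)) /=.
  rewrite [X in _ + X]big1 ?addn0 // => x xA; apply/eqP; rewrite cards_eq0.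
  apply: contraNT xA => /set0Pn[a]; rewrite in_setI mem_lcoset => /andP[aA xaA].
  apply/mulsgP; exists a (x^-1 * a)^-1%g; rewrite ?mem_invg ?invgK //.
  by rewrite invMg invgK mulKVg.
apply: leq_trans (sum_sqr_le _ _) _; rewrite leq_mul2l; apply/orP; right.
exact: leq_sum_subset.
Qed.

Lemma popularV S L : ((popular S L)^-1)%g = popular S L.
Proof. by apply/setP => x; rewrite mem_invg !inE repV. Qed.

Lemma one_popular S L : 0 < L -> 1%g \in popular S L.
Proof. by move=> L0; rewrite inE rep1 leq_pmull. Qed.

Section SmallDoubling.
Variables (A : {set gT}) (K : nat).
Hypotheses (A0 : 0 < #|A|) (dA : #|(A * A^-1)%g| <= K * #|A|).

Let D := popular (A^-1)%g (2 * K).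

Let massD : #|A| ^ 2 <= 2 * K * \sum_(x in D) rep (A^-1)%g x.
Proof.
rewrite -(card_invg A); apply: popular_mass; rewrite energyV card_invg.
rewrite -(leq_pmul2r A0) -expnSr mulnAC.
exact: leq_trans (energy_lower A) (leq_mul dA (leqnn _)).
Qed.

Lemma popular_card_ge : #|A| <= 2 * K * #|D|.
Proof.
rewrite -(leq_pmul2r A0) mulnn; apply: leq_trans massD _.
rewrite -[X in _ <= X]mulnA leq_mul2l -sum_nat_const; apply/orP; right; apply: leq_sum => x _.
by rewrite -(card_invg A) rep_le.
Qed.

Lemma popular_coset : exists2 a, a \in A & #|A| <= 2 * K * #|A :&: (a *: D)%g|.
Proof.
have e : \sum_(x in D) rep (A^-1)%g x = \sum_(a in A) #|A :&: (a *: D)%g|.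
  transitivity (\sum_x rep (A^-1)%g x * (x \in D)).
    by rewrite big_mkcond; apply: eq_bigr => x _; case: (x \in D); rewrite ?muln1 ?muln0.
  rewrite -(sum_rep _ (fun x => x \in D)) sum_invg; apply: eq_bigr => a _.
  rewrite sum_invg -(card_sum_bool A (fun b => (a^-1 * b^-1^-1)%g \in D)).
  congr #|pred_of_set _|; apply/setP => b.
  by rewrite in_set in_setI mem_lcoset invgK.
by apply: leq_avg => //; rewrite mulnn -big_distrr -e.
Qed.

(* Each d in D has many decompositions d = x y^-1 with x, y in A^-1, and each of them
   writes z d a^-1 as the product of z x and y^-1 a^-1. *)
Lemma card_popular_mul Z :
  #|(Z * D * A^-1)%g| <= 2 * K ^ 2 * #|(Z * A^-1)%g|.
Proof.
rewrite -(leq_pmul2r A0).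
apply: leq_trans (_ : 2 * K * (#|(Z * A^-1)%g| * #|(A * A^-1)%g|) <= _); last first.
  by rewrite -mulnn; have := leq_mul (leqnn (2 * K * #|(Z * A^-1)%g|)) dA; lia.
pose r w := \sum_(u in (Z * A^-1)%g) ((u^-1 * w)%g \in (A * A^-1)%g).
apply: leq_trans (_ : \sum_(w in (Z * D * A^-1)%g) 2 * K * r w <= _).
  rewrite -sum_nat_const; apply: leq_sum => w /mulsgP[zd a'] /mulsgP[z d zZ dD -> a'A ->].
  move: dD; rewrite inE card_invg => /leq_trans; apply; rewrite leq_mul2l; apply/orP; right.
  rewrite /rep -(card_lcoset _ z) /r -(card_sum_bool (Z * A^-1)%g (fun u => (u^-1 * _)%g \in _)).
  apply/subset_leq_card/subsetP => u; rewrite mem_lcoset in_setI mem_lcoset => /andP[h1 h2].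
  rewrite in_set; apply/andP; split; first by rewrite -(mulKVg z u) mem_mulg.
  have -> : (u^-1 * (z * d * a') = (d^-1 * (z^-1 * u))^-1 * a')%g by rewrite !invMg !invgK !mulgA.
  by rewrite mem_mulg // -mem_invg.
rewrite -big_distrr leq_mul2l exchange_big -sum_nat_const; apply/orP; right => /=.
apply: leq_sum => u _; rewrite -(card_sum_bool _ (fun w => (u^-1 * w)%g \in (A * A^-1)%g)).
rewrite -(card_lcoset (A * A^-1)%g u); apply/subset_leq_card/subsetP => w.
by rewrite in_set mem_lcoset => /andP[].
Qed.

Lemma card_popular_exp n : #|(D ^+ n)%g| <= (2 * K ^ 2) ^ n * #|A|.
Proof.
have h : #|(D ^+ n * A^-1)%g| <= (2 * K ^ 2) ^ n * #|A|.
  elim: n => [|n IHn]; first by rewrite expg0 mul1g card_invg mul1n.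
  rewrite expgSr; apply: leq_trans (card_popular_mul _) _.
  by rewrite (expnS (2 * K ^ 2)) -(mulnA (2 * K ^ 2)) leq_mul2l IHn orbT.
have [a aA] : exists a, a \in A by apply/card_gt0P.
apply: leq_trans h; rewrite -(card_rcoset (D ^+ n)%g a^-1%g).
by apply/subset_leq_card/mulgS; rewrite sub1set mem_invg invgK.
Qed.

End SmallDoubling.
End Approx.

Local Open Scope ring_scope.

(** * Two by two matrices *)

Section Mx2Ring.
Variable F : comNzRingType.
Implicit Types (m n x y : 'M[F]_2) (v : 'cV[F]_2).

Lemma mulmx2E q (m : 'M[F]_2) (n : 'M[F]_(2, q)) i j :
  (m *m n) i j = m i 0 * n 0 j + m i 1 * n 1 j.
Proof. by rewrite mxE !big_ord_recl big_ord0 addr0; congr (_ + m i _ * n _ j); apply: val_inj. Qed.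

Lemma mxtrace2E m : \tr m = m 0 0 + m 1 1.
Proof. by rewrite /mxtrace !big_ord_recl big_ord0 addr0; congr (_ + m _ _); apply: val_inj. Qed.

Lemma ord2P (i : 'I_2) : (i = 0) \/ (i = 1).
Proof. by case: i => [[|[|//]] h]; [left|right]; apply: val_inj. Qed.

Lemma mx2_eq m n : m 0 0 = n 0 0 -> m 0 1 = n 0 1 -> m 1 0 = n 1 0 -> m 1 1 = n 1 1 -> m = n.
Proof. by move=> h1 h2 h3 h4; apply/matrixP => i j; case: (ord2P i) (ord2P j) => -> [] ->. Qed.

Lemma cV2_eq (v w : 'cV[F]_2) : v 0 0 = w 0 0 -> v 1 0 = w 1 0 -> v = w.
Proof. by move=> h1 h2; apply/colP => i; case: (ord2P i) => ->. Qed.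

End Mx2Ring.

Lemma det2E (R : comNzRingType) (m : 'M[R]_2) : \det m = m 0 0 * m 1 1 - m 0 1 * m 1 0.
Proof.
rewrite (expand_det_row m 0) !big_ord_recl big_ord0 addr0 /cofactor !det_mx11 !mxE.
rewrite !expr0 mul1r expr1 mulN1r mulrN.
by congr (_ * m _ _ - m _ _ * m _ _); apply: val_inj.
Qed.

Definition mx2E := (mulmx2E, mxtrace2E, det2E, mxE).

Section Mx2Field.
Variable F : fieldType.
Implicit Types (m n x y : 'M[F]_2) (v : 'cV[F]_2).

Lemma mulmx_adj2 x : \det x = 1 -> x *m ((\tr x)%:M - x) = 1%:M.
Proof.
rewrite !mx2E => h; apply: mx2_eq; rewrite !mx2E /= -?h ?mulr1n ?mulr0n; ring.
Qed.

Lemma mulmx_adj2l x : \det x = 1 -> ((\tr x)%:M - x) *m x = 1%:M.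
Proof.
rewrite !mx2E => h; apply: mx2_eq; rewrite !mx2E /= -?h ?mulr1n ?mulr0n; ring.
Qed.

Lemma parallel2 (v w : 'cV[F]_2) : v != 0 -> v 0 0 * w 1 0 = v 1 0 * w 0 0 ->
  exists c, w = c *: v.
Proof.
move=> v0 h; case: (eqVneq (v 0 0) 0) => [e|e].
  have e1 : v 1 0 != 0.
    by apply: contraNneq v0 => e1; apply/eqP/cV2_eq; rewrite !mxE.
  exists (w 1 0 / v 1 0); apply: cV2_eq; rewrite mxE; last by field.
  by apply: (mulfI e1); rewrite -h e mul0r !mulr0.
exists (w 0 0 / v 0 0); apply: cV2_eq; rewrite mxE; first by field.
by apply: (mulfI e); rewrite h; field.
Qed.

Definition eigen m v := exists c, m *m v = c *: v.

Lemma nilpotent_eigen n : n != 0 -> \tr n = 0 -> \det n = 0 ->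
  exists2 v, v != 0 & forall m, \tr (m *m n) = 0 -> eigen m v.
Proof.
move=> n0; rewrite !mx2E => htr hdet.
have h11 : n 1 1 = - n 0 0 by apply/eqP; rewrite -addr_eq0 addrC htr.
rewrite h11 in hdet.
case: (eqVneq (n 1 0) 0) => [e|e].
  have e0 : n 0 0 = 0.
    by move/eqP: hdet; rewrite e mulr0 subr0 mulrN oppr_eq0 mulf_eq0 orbb => /eqP.
  have e1 : n 0 1 != 0.
    by apply: contraNneq n0 => e1; apply/eqP/mx2_eq; rewrite !mxE // h11 e0 oppr0.
  exists (\col_i (i == 0)%:R).
    by apply/negP => /eqP/colP/(_ 0); rewrite !mxE /= => /eqP; rewrite oner_eq0.
  move=> m; rewrite !mx2E e h11 e0 oppr0 !mulr0 !add0r addr0 => /eqP.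
  rewrite mulf_eq0 (negbTE e1) orbF => /eqP hm.
  by exists (m 0 0); apply: cV2_eq; rewrite !mx2E /= ?hm; ring.
exists (\col_i n i 0).
  by apply: contraNneq e => /colP/(_ 1); rewrite !mxE => ->.
move=> m; rewrite !mx2E h11 => hm; apply: parallel2.
  by apply: contraNneq e => /colP/(_ 1); rewrite !mxE => ->.
rewrite !mx2E; apply/eqP; rewrite -subr_eq0; apply/eqP.
transitivity (- (n 1 0 * (m 0 0 * n 0 0 + m 0 1 * n 1 0 + (m 1 0 * n 0 1 + m 1 1 * - n 0 0)))
   - m 1 0 * (n 0 0 * - n 0 0 - n 0 1 * n 1 0)); first by ring.
by rewrite hm hdet; ring.
Qed.

Lemma line_quadric x n c : \tr n = 0 -> c != 0 -> c != 1 ->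
  \det x = 1 -> \det (x + n) = 1 -> \det (x + c *: n) = 1 ->
  \det n = 0 /\ \tr (x *m n) = 0.
Proof.
move=> hn c0 c1 hx h1 h2.
have e s : \det (x + s *: n) = \det x + s * (\tr x * \tr n - \tr (x *m n)) + s ^+ 2 * \det n.
  by rewrite !mx2E; ring.
have := e 1; rewrite scale1r h1 hx hn => e1; have := e c; rewrite h2 hx hn => e2.
have d0 : \det n = \tr (x *m n).
  by apply/eqP; rewrite -subr_eq0; apply/eqP; apply: (addrI (1 : F)); rewrite addr0 [RHS]e1; ring.
suff : \tr (x *m n) = 0 by rewrite d0.
have c10 : c * (c - 1) != 0 by rewrite mulf_neq0 // subr_eq0.
apply: (mulfI c10); apply: (addrI (1 : F)); rewrite mulr0 addr0 [RHS]e2 d0; ring.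
Qed.

Lemma prop3 (n1 n2 n3 w1 w2 w3 : F) : [|| w1 != 0, w2 != 0 | w3 != 0] ->
  n1 * w2 = n2 * w1 -> n1 * w3 = n3 * w1 -> n2 * w3 = n3 * w2 ->
  exists c, [/\ n1 = c * w1, n2 = c * w2 & n3 = c * w3].
Proof.
case/or3P => h e1 e2 e3.
- by exists (n1 / w1); split; apply: (mulIf h); rewrite -?e1 -?e2; field.
- by exists (n2 / w2); split; apply: (mulIf h); rewrite -?e3 ?e1; field.
by exists (n3 / w3); split; apply: (mulIf h); rewrite ?e2 ?e3; field.
Qed.

Lemma cross3 (u1 u2 u3 v1 v2 v3 n1 n2 n3 : F) :
  n1 * u1 + n2 * u2 + n3 * u3 = 0 -> n1 * v1 + n2 * v2 + n3 * v3 = 0 ->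
  let w1 := u2 * v3 - u3 * v2 in let w2 := u3 * v1 - u1 * v3 in let w3 := u1 * v2 - u2 * v1 in
  [|| w1 != 0, w2 != 0 | w3 != 0] ->
  exists c, [/\ n1 = c * w1, n2 = c * w2 & n3 = c * w3].
Proof.
move=> h1 h2 w1 w2 w3 h; apply: prop3 h _ _ _; rewrite /w1 /w2 /w3; apply/eqP; rewrite -subr_eq0; apply/eqP.
- transitivity (u3 * (n1 * v1 + n2 * v2 + n3 * v3) - v3 * (n1 * u1 + n2 * u2 + n3 * u3)); first by ring.
  by rewrite h1 h2; ring.
- transitivity (v2 * (n1 * u1 + n2 * u2 + n3 * u3) - u2 * (n1 * v1 + n2 * v2 + n3 * v3)); first by ring.
  by rewrite h1 h2; ring.
transitivity (u1 * (n1 * v1 + n2 * v2 + n3 * v3) - v1 * (n1 * u1 + n2 * u2 + n3 * u3)); first by ring.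
by rewrite h1 h2; ring.
Qed.

Lemma cross0_dependent (y z : 'M[F]_2) :
  y 1 0 * z 0 1 - y 0 1 * z 1 0 = 0 ->
  y 0 1 * (z 0 0 - z 1 1) - (y 0 0 - y 1 1) * z 0 1 = 0 ->
  (y 0 0 - y 1 1) * z 1 0 - y 1 0 * (z 0 0 - z 1 1) = 0 ->
  exists a b, (a != 0) || (b != 0) /\ exists d, a *: y + b *: z = d%:M.
Proof.
move=> a1 a2 a3.
case: (boolP [|| y 0 0 - y 1 1 != 0, y 1 0 != 0 | y 0 1 != 0]) => hu.
  have [||| c [c1 c2 c3]] := prop3 (n1 := z 0 0 - z 1 1) (n2 := z 1 0) (n3 := z 0 1) hu.
  - by apply/eqP; rewrite -subr_eq0 -oppr_eq0 -a3; apply/eqP; ring.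
  - by apply/eqP; rewrite -subr_eq0 -a2; apply/eqP; ring.
  - by apply/eqP; rewrite -subr_eq0 -oppr_eq0 -a1; apply/eqP; ring.
  exists c, (-1); split; first by rewrite oppr_eq0 oner_eq0 orbT.
  exists (c * y 1 1 - z 1 1); apply: mx2_eq; rewrite !mxE /= ?c2 ?c3 ?mulr1n ?mulr0n; try ring.
  apply/eqP; rewrite -subr_eq0; apply/eqP.
  transitivity (c * (y 0 0 - y 1 1) - (z 0 0 - z 1 1)); first by ring.
  by rewrite c1 subrr.
move: hu; rewrite !negb_or !negbK subr_eq0 => /and3P[/eqP b1 /eqP b2 /eqP b3].
exists 1, 0; split; first by rewrite oner_eq0.
by exists (y 0 0); apply: mx2_eq; rewrite !mxE /= ?b2 ?b3 ?b1 ?mulr1n ?mulr0n; ring.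
Qed.

(* If the trace conditions against x x2 and x x3 are independent of each other and of the
   trace, then x, x', x'' are collinear; otherwise x^-1, x2, x3 are. In both cases a line
   lies on the quadric det = 1, and its direction is nilpotent. *)
Lemma fibre_degenerate (t : F) x x' x'' x2 x3 : t != 0 ->
  \det x = 1 -> \det x' = 1 -> \det x'' = 1 -> \det x2 = 1 -> \det x3 = 1 ->
  \tr x = t -> \tr x' = t -> \tr x'' = t -> \tr x2 = t -> \tr x3 = t ->
  \tr (x' *m (x *m x2)) = \tr (x *m (x *m x2)) ->
  \tr (x'' *m (x *m x2)) = \tr (x *m (x *m x2)) ->
  \tr (x' *m (x *m x3)) = \tr (x *m (x *m x3)) ->
  \tr (x'' *m (x *m x3)) = \tr (x *m (x *m x3)) ->
  x != x' -> x != x'' -> x' != x'' ->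
  [\/ x *m x2 = 1%:M, x *m x3 = 1%:M, x2 = x3 |
    exists2 v, v != 0 & [/\ eigen x v, eigen x2 v & eigen x3 v]].
Proof.
move=> t0 dx dx' dx'' dx2 dx3 tx tx' tx'' tx2 tx3.
set y1 := x *m x2; set y2 := x *m x3 => e1 e1' e2 e2' nxx' nxx'' nx'x''.
pose n := x' - x; pose n' := x'' - x.
have n0 : n != 0 by rewrite subr_eq0 eq_sym.
have n0' : n' != 0 by rewrite subr_eq0 eq_sym.
have tn : \tr n = 0 by rewrite raddfB /= tx' tx subrr.
have tn' : \tr n' = 0 by rewrite raddfB /= tx'' tx subrr.
have f1 : \tr (n *m y1) = 0 by rewrite mulmxBl raddfB /= e1 subrr.
have f2 : \tr (n *m y2) = 0 by rewrite mulmxBl raddfB /= e2 subrr.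
have f1' : \tr (n' *m y1) = 0 by rewrite mulmxBl raddfB /= e1' subrr.
have f2' : \tr (n' *m y2) = 0 by rewrite mulmxBl raddfB /= e2' subrr.
have trE (m y : 'M[F]_2) : \tr m = 0 ->
    \tr (m *m y) = m 0 0 * (y 0 0 - y 1 1) + m 0 1 * y 1 0 + m 1 0 * y 0 1.
  rewrite !mx2E => h; have -> : m 1 1 = - m 0 0 by apply/eqP; rewrite -addr_eq0 addrC h.
  by ring.
pose w1 := y1 1 0 * y2 0 1 - y1 0 1 * y2 1 0.
pose w2 := y1 0 1 * (y2 0 0 - y2 1 1) - (y1 0 0 - y1 1 1) * y2 0 1.
pose w3 := (y1 0 0 - y1 1 1) * y2 1 0 - y1 1 0 * (y2 0 0 - y2 1 1).
case: (boolP [|| w1 != 0, w2 != 0 | w3 != 0]) => hw.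
  rewrite !trE // in f1 f2 f1' f2'.
  have [c [c1 c2 c3]] := cross3 f1 f2 hw.
  have [c' [c1' c2' c3']] := cross3 f1' f2' hw.
  rewrite -/w1 -/w2 -/w3 in c1 c2 c3 c1' c2' c3'.
  have nz m : m != 0 -> \tr m = 0 -> [|| m 0 0 != 0, m 0 1 != 0 | m 1 0 != 0].
    move=> m0 htr; apply: contraNT m0; rewrite !negb_or !negbK => /and3P[/eqP a /eqP b /eqP d].
    apply/eqP/mx2_eq; rewrite !mxE //.
    by move: htr; rewrite mxtrace2E a add0r.
  have c0 : c != 0.
    by apply: contraTneq (nz n n0 tn) => e; rewrite c1 c2 c3 e !mul0r eqxx.
  have c0' : c' != 0.
    by apply: contraTneq (nz n' n0' tn') => e; rewrite c1' c2' c3' e !mul0r eqxx.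
  pose s := c' / c.
  have en' : n' = s *: n.
    have d m : \tr m = 0 -> m 1 1 = - m 0 0.
      by rewrite mxtrace2E => h; apply/eqP; rewrite -addr_eq0 addrC h.
    apply: mx2_eq; rewrite [RHS]mxE ?(d n') ?(d n) // ?c1 ?c2 ?c3 ?c1' ?c2' ?c3' /s; by field.
  have s0 : s != 0 by rewrite mulf_neq0 // invr_eq0.
  have s1 : s != 1.
    apply: contraNneq nx'x'' => e; move: en'; rewrite e scale1r /n /n'.
    by move/addIr => ->.
  have [dn txn] : \det n = 0 /\ \tr (x *m n) = 0.
    have h1 : x + n = x' by rewrite /n addrC subrK.
    have h2 : x + s *: n = x'' by rewrite -en' /n' addrC subrK.
    by apply: (line_quadric tn s0 s1 dx); [rewrite h1 dx' | rewrite h2 dx''].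
  have [v v0 hv] := nilpotent_eigen n0 tn dn.
  constructor 4; exists v => //.
  have [l hl] := hv x txn.
  have l0 : l != 0.
    apply: contraNneq v0 => e; rewrite -[v]mul1mx -(mulmx_adj2l dx) -mulmxA hl e.
    by rewrite scale0r mulmx0.
  have aux z : \tr ((x *m z) *m n) = 0 -> eigen z v.
    move/hv => [c4 hc4]; exists (c4 / l).
    rewrite -[z *m v]mul1mx -(mulmx_adj2l dx) -mulmxA (mulmxA x) hc4 -scalemxAr -scalerA.
    congr (_ *: _); apply: (scalerI l0); rewrite scalerA divff // scale1r scalemxAr -hl.
    by rewrite mulmxA mulmx_adj2l // mul1mx.
  split; first by exists l.
    by apply: aux; rewrite mxtrace_mulC -/y1 trE.
  by apply: aux; rewrite mxtrace_mulC -/y2 trE.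
have [a [b [hab [d hd]]]] : exists a b, (a != 0) || (b != 0) /\ exists d, a *: y1 + b *: y2 = d%:M.
  by move: hw; rewrite !negb_or !negbK => /and3P[/eqP a1 /eqP a2 /eqP a3]; apply: cross0_dependent.
have [xi xiE] : exists xi, xi = t%:M - x by exists (t%:M - x).
have xix : xi *m x = 1%:M by rewrite xiE -tx mulmx_adj2l.
have xxi : x *m xi = 1%:M by rewrite xiE -tx mulmx_adj2.
have txi : \tr xi = t by rewrite xiE raddfB /= tx mxtrace_scalar mulr2n addrK.
have hd' : a *: x2 + b *: x3 = d *: xi.
  have := congr1 (mulmx xi) hd; rewrite mulmxDr -!scalemxAr !mulmxA xix !mul1mx => ->.
  by rewrite -scalemx1 -scalemxAr mulmx1.
have dE : d = a + b.
  have := congr1 (@mxtrace F 2) hd'; rewrite raddfD /= !mxtraceZ tx2 tx3 txi -mulrDl.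
  by move/(mulIf t0).
have dxi : \det xi = 1.
  by have := congr1 determinant xix; rewrite det_mulmx dx mulr1 det1.
rewrite {}dE scalerDl in hd'.
case: (eqVneq x2 xi) => [e|n2]; first by constructor 1; rewrite /y1 e.
case: (eqVneq x3 xi) => [e|n3]; first by constructor 2; rewrite /y2 e.
case: (eqVneq x2 x3) => [|n23]; first by constructor 3.
constructor 4; pose m := x2 - xi.
have m0 : m != 0 by rewrite subr_eq0.
have tm : \tr m = 0 by rewrite raddfB /= tx2 txi subrr.
have hd2 : a *: m = - (b *: (x3 - xi)).
  rewrite /m !scalerBr opprB; apply/eqP; rewrite subr_eq addrAC.
  by rewrite (addrC (b *: xi)) -hd' addrK.
have b0 : b != 0.
  apply: contraTneq hab => e; move: hd2; rewrite e scale0r oppr0 => /eqP.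
  by rewrite scaler_eq0 (negbTE m0) orbF eqxx orbF => ->.
have a0 : a != 0.
  apply: contraTneq hab => e; move: hd2; rewrite e scale0r => /eqP.
  by rewrite eq_sym oppr_eq0 scaler_eq0 subr_eq0 (negbTE n3) orbF eqxx => ->.
pose e := - a / b.
have x3E : x3 = xi + e *: m.
  apply: (scalerI b0); rewrite scalerDr scalerA /e mulrC mulfVK // scaleNr hd2 opprK.
  by rewrite scalerBr addrC subrK.
have e0 : e != 0 by rewrite mulf_neq0 ?oppr_eq0 ?invr_eq0.
have e1n : e != 1.
  by apply: contraNneq n23 => h; rewrite x3E h scale1r addrC subrK.
have [dm txim] : \det m = 0 /\ \tr (xi *m m) = 0.
  have h1 : xi + m = x2 by rewrite /m addrC subrK.
  by apply: (line_quadric tm e0 e1n dxi); [rewrite h1 dx2 | rewrite -x3E dx3].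
have [v v0 hv] := nilpotent_eigen m0 tm dm; exists v => //.
have trm2 : \tr (m *m m) = 0.
  transitivity ((\tr m) ^+ 2 - 2 * \det m); first by rewrite !mx2E; ring.
  by rewrite tm dm mulr0 subr0 expr0n.
split; apply: hv.
- have -> : x = t%:M - xi by rewrite xiE opprB addrC subrK.
  by rewrite mulmxBl raddfB /= txim mul_scalar_mx mxtraceZ tm mulr0 subr0.
- have -> : x2 = xi + m by rewrite addrC subrK.
  by rewrite mulmxDl raddfD /= txim trm2 addr0.
by rewrite x3E mulmxDl raddfD /= txim -scalemxAl mxtraceZ trm2 mulr0 addr0.
Qed.
End Mx2Field.

Lemma leq_card_fibres (T T' : finType) (A : {set T}) (B : {set T'}) (f : T -> T') c :
  (forall x, x \in A -> f x \in B) ->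
  (forall y, y \in B -> (#|[set x in A | f x == y]| <= c)%N) -> (#|A| <= c * #|B|)%N.
Proof.
move=> fAB hc; rewrite -sum1_card (partition_big f (mem B)) //= mulnC -sum_nat_const.
apply: leq_sum => y /hc; apply: leq_trans; rewrite -sum1_card.
by apply: eq_leq; apply: eq_bigl => x; rewrite inE.
Qed.

Lemma leq_card_in_inj (T T' : finType) (A : {set T}) (B : {set T'}) (f : T -> T') :
  (forall x, x \in A -> f x \in B) -> {in A &, injective f} -> (#|A| <= #|B|)%N.
Proof.
move=> fAB fI; rewrite -(card_in_imset fI).
by apply/subset_leq_card/subsetP => _ /imsetP[x xA ->]; apply: fAB.
Qed.

Lemma leq_card_bigcup (I T : finType) (U : {set I}) (B : I -> {set T}) c :
  (forall i, i \in U -> (#|B i| <= c)%N) -> (#|\bigcup_(i in U) B i| <= #|U| * c)%N.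
Proof.
move=> h; rewrite -sum_nat_const; elim/big_rec2: _ => [|i n C iU]; first by rewrite cards0.
by move=> hC; apply: leq_trans (leq_card_setU _ _) _; apply: leq_add (h i iU) hC.
Qed.

Lemma card_le2 (T : finType) (A : {set T}) :
  (forall x y z, x \in A -> y \in A -> z \in A -> [\/ x = y, y = z | x = z]) -> (#|A| <= 2)%N.
Proof.
move=> h; rewrite leqNgt; apply/negP => /card_gt2P[x [y [z [[xA yA zA] [xy yz zx]]]]].
by case: (h x y z xA yA zA) => e; move: xy yz zx; rewrite e ?eqxx.
Qed.

Section Mx2.
Variable F : fieldType.
Implicit Types (g m n x y z : 'M[F]_2) (v w : 'cV[F]_2).

Lemma eigen_char x v c : v != 0 -> x *m v = c *: v -> c ^+ 2 - \tr x * c + \det x = 0.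
Proof.
move=> v0 h; have h0 := congr1 (fun w : 'cV_2 => w 0 0) h; have h1 := congr1 (fun w : 'cV_2 => w 1 0) h.
rewrite !mx2E in h0 h1.
have e0 : (c ^+ 2 - \tr x * c + \det x) * v 0 0 = 0.
  rewrite !mx2E.
  transitivity ((c - x 1 1) * (c * v 0 0 - (x 0 0 * v 0 0 + x 0 1 * v 1 0)) +
     x 0 1 * (c * v 1 0 - (x 1 0 * v 0 0 + x 1 1 * v 1 0))); first by ring.
  by rewrite h0 h1; ring.
have e1 : (c ^+ 2 - \tr x * c + \det x) * v 1 0 = 0.
  rewrite !mx2E.
  transitivity ((c - x 0 0) * (c * v 1 0 - (x 1 0 * v 0 0 + x 1 1 * v 1 0)) +
     x 1 0 * (c * v 0 0 - (x 0 0 * v 0 0 + x 0 1 * v 1 0))); first by ring.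
  by rewrite h0 h1; ring.
apply/eqP; apply: contraNT v0 => e; apply/eqP/cV2_eq; rewrite mxE; apply: (mulfI e).
  by rewrite e0 mulr0.
by rewrite e1 mulr0.
Qed.

Lemma eigen_scalar x v w c : v 0 0 * w 1 0 != v 1 0 * w 0 0 ->
  x *m v = c *: v -> x *m w = c *: w -> x = c%:M.
Proof.
move=> d hv hw.
have v0 := congr1 (fun w : 'cV_2 => w 0 0) hv; have v1 := congr1 (fun w : 'cV_2 => w 1 0) hv.
have w0 := congr1 (fun w : 'cV_2 => w 0 0) hw; have w1 := congr1 (fun w : 'cV_2 => w 1 0) hw.
rewrite !mx2E in v0 v1 w0 w1; rewrite -subr_eq0 in d.
apply: mx2_eq; rewrite !mxE /= ?mulr1n ?mulr0n; apply: (mulIf d).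
- transitivity (w 1 0 * (x 0 0 * v 0 0 + x 0 1 * v 1 0) - v 1 0 * (x 0 0 * w 0 0 + x 0 1 * w 1 0)); first by ring.
  by rewrite v0 w0; ring.
- transitivity (v 0 0 * (x 0 0 * w 0 0 + x 0 1 * w 1 0) - w 0 0 * (x 0 0 * v 0 0 + x 0 1 * v 1 0)); first by ring.
  by rewrite v0 w0; ring.
- transitivity (w 1 0 * (x 1 0 * v 0 0 + x 1 1 * v 1 0) - v 1 0 * (x 1 0 * w 0 0 + x 1 1 * w 1 0)); first by ring.
  by rewrite v1 w1; ring.
transitivity (v 0 0 * (x 1 0 * w 0 0 + x 1 1 * w 1 0) - w 0 0 * (x 1 0 * v 0 0 + x 1 1 * v 1 0)); first by ring.
by rewrite v1 w1; ring.
Qed.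

Lemma eigen_parallel x v w c : (forall d, x != d%:M) -> v != 0 ->
  x *m v = c *: v -> x *m w = c *: w -> exists d, w = d *: v.
Proof.
move=> nx v0 hv hw; apply: (parallel2 v0); apply/eqP; apply: contraNT (nx c) => d.
by apply/eqP; apply: eigen_scalar d hv hw.
Qed.

Lemma commute_span g x : (forall d, g != d%:M) -> x *m g = g *m x ->
  exists a b, x = a%:M + b *: g.
Proof.
move=> ng h.
have h00 := congr1 (fun m : 'M_2 => m 0 0) h; have h01 := congr1 (fun m : 'M_2 => m 0 1) h.
have h10 := congr1 (fun m : 'M_2 => m 1 0) h.
rewrite !mx2E in h00 h01 h10.
have hg : [|| g 0 0 - g 1 1 != 0, g 0 1 != 0 | g 1 0 != 0].
  apply: contraNT (ng (g 0 0)); rewrite !negb_or !negbK subr_eq0 => /and3P[/eqP a /eqP b /eqP c].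
  by apply/eqP/mx2_eq; rewrite !mxE /= ?mulr1n ?mulr0n ?b ?c ?a.
have [||| b [b1 b2 b3]] := prop3 (n1 := x 0 0 - x 1 1) (n2 := x 0 1) (n3 := x 1 0) hg.
- apply/eqP; rewrite -subr_eq0; apply/eqP.
  transitivity (x 0 0 * g 0 1 + x 0 1 * g 1 1 - (g 0 0 * x 0 1 + g 0 1 * x 1 1)); first by ring.
  by rewrite h01 subrr.
- apply/eqP; rewrite -subr_eq0; apply/eqP.
  transitivity (- (x 1 0 * g 0 0 + x 1 1 * g 1 0 - (g 1 0 * x 0 0 + g 1 1 * x 1 0))); first by ring.
  by rewrite h10 subrr oppr0.
- apply/eqP; rewrite -subr_eq0; apply/eqP.
  transitivity (x 0 0 * g 0 0 + x 0 1 * g 1 0 - (g 0 0 * x 0 0 + g 0 1 * x 1 0)); first by ring.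
  by rewrite h00 subrr.
exists (x 0 0 - b * g 0 0), b; apply: mx2_eq; rewrite !mxE /= ?mulr1n ?mulr0n ?b2 ?b3; try ring.
have -> : x 1 1 = x 0 0 - (x 0 0 - x 1 1) by ring.
by rewrite b1; ring.
Qed.

Lemma sqr_three (a b c : F) : a ^+ 2 = b ^+ 2 -> b ^+ 2 = c ^+ 2 -> [\/ a = b, b = c | a = c].
Proof.
move=> /eqP h1 /eqP h2; move: h1 h2; rewrite !eqf_sqr => /orP[/eqP->|/eqP->]; first by constructor 1.
by case/orP=> /eqP h; [constructor 2|constructor 3; rewrite h opprK].
Qed.

Lemma scalar_trace (d : F) : \det (d%:M : 'M[F]_2) = 1 -> (\tr (d%:M : 'M[F]_2)) ^+ 2 = 4.
Proof.
rewrite det_scalar mxtrace_scalar => dd.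
by transitivity (4 * d ^+ 2); [ring | rewrite dd; ring].
Qed.

Lemma torus_trace g x y z : (2 : F) != 0 -> \det g = 1 -> (\tr g) ^+ 2 != 4 ->
  x *m g = g *m x -> y *m g = g *m y -> z *m g = g *m z ->
  \det x = 1 -> \det y = 1 -> \det z = 1 -> \tr x = \tr y -> \tr y = \tr z ->
  [\/ x = y, y = z | x = z].
Proof.
move=> n2 dg tg.
have ng d : g != d%:M.
  by apply: contraNneq tg => e; move: dg; rewrite e => /scalar_trace ->.
move=> /(commute_span ng)[a1 [b1 e1]] /(commute_span ng)[a2 [b2 e2]] /(commute_span ng)[a3 [b3 e3]].
have tE a b : \tr (a%:M + b *: g) = 2 * a + b * \tr g.
  by rewrite raddfD /= mxtrace_scalar mxtraceZ mulr_natl.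
have dE a b : \det (a%:M + b *: g) = 1 ->
    b ^+ 2 = (4 - (\tr (a%:M + b *: g)) ^+ 2) / (4 - (\tr g) ^+ 2).
  have e : \det (a%:M + b *: g) = a ^+ 2 + a * b * \tr g + b ^+ 2 * \det g.
    by rewrite !mx2E /= !mulr1n !mulr0n; ring.
  rewrite e dg mulr1 tE => h; apply: (mulIf (x := 4 - (\tr g) ^+ 2)).
    by rewrite subr_eq0 eq_sym.
  rewrite mulfVK; last by rewrite subr_eq0 eq_sym.
  transitivity (4 * (a ^+ 2 + a * b * \tr g + b ^+ 2) - (2 * a + b * \tr g) ^+ 2); first by ring.
  by rewrite h mulr1.
move=> dx dy dz txy tyz.
have hb1 : b1 ^+ 2 = (4 - (\tr x) ^+ 2) / (4 - (\tr g) ^+ 2) by rewrite (dE a1 b1) -?e1.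
have hb2 : b2 ^+ 2 = (4 - (\tr y) ^+ 2) / (4 - (\tr g) ^+ 2) by rewrite (dE a2 b2) -?e2.
have hb3 : b3 ^+ 2 = (4 - (\tr z) ^+ 2) / (4 - (\tr g) ^+ 2) by rewrite (dE a3 b3) -?e3.
have [||bb|bb|bb] := @sqr_three b1 b2 b3.
- by rewrite hb1 hb2 txy.
- by rewrite hb2 hb3 tyz.
- constructor 1; rewrite e1 e2 bb; congr (_%:M + _); apply: (mulfI n2).
  by apply: (addIr (b2 * \tr g)); rewrite -tE -{1}bb -e1 -tE -e2.
- constructor 2; rewrite e2 e3 bb; congr (_%:M + _); apply: (mulfI n2).
  by apply: (addIr (b3 * \tr g)); rewrite -tE -{1}bb -e2 -tE -e3.
constructor 3; rewrite e1 e3 bb; congr (_%:M + _); apply: (mulfI n2).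
by apply: (addIr (b3 * \tr g)); rewrite -tE -{1}bb -e1 -tE -e3 txy.
Qed.

(* The Gram matrix would be scalar of size 4 but of rank at most 3. *)
Lemma no_orthogonal4 (X : 'I_4 -> 'M[F]_2) : (2 : F) != 0 ->
  (forall i, \tr (X i) = 0) -> (forall i, \det (X i) = 1) ->
  (forall i j : 'I_4, (i < j)%N -> \tr (X i *m X j) = 0) -> False.
Proof.
move=> n2 tX dX oX.
have e11 i : X i 1 1 = - X i 0 0.
  by apply/eqP; rewrite -addr_eq0 addrC -mxtrace2E tX.
have oX' i j : i != j -> \tr (X i *m X j) = 0.
  case: (ltngtP i j) => [/oX //|/oX <- _|/val_inj -> /eqP //].
  exact: mxtrace_mulC.
pose M := \matrix_(i < 4, j < 3) [:: X i 0 0; X i 0 1; X i 1 0]`_j.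
pose N := \matrix_(i < 3, j < 4) [:: 2 * X j 0 0; X j 1 0; X j 0 1]`_i.
have MN : M *m N = (- 2)%:M.
  apply/matrixP => i j; rewrite !mxE !big_ord_recl big_ord0 !mxE /= addr0.
  have -> : X i 0 0 * (2 * X j 0 0) + (X i 0 1 * X j 1 0 + X i 1 0 * X j 0 1) = \tr (X i *m X j).
    by rewrite !mx2E !e11; ring.
  case: (eqVneq i j) => [->|/oX' -> //].
  transitivity (- 2 * \det (X j)); last by rewrite dX mulr1.
  by rewrite !mx2E !e11; ring.
have : (\rank (M *m N) <= 3)%N by apply: leq_trans (mxrankM_maxl _ _) (rank_leq_col _).
by rewrite MN -scalemx1 mxrank_scale_nz ?oppr_eq0 // mxrank1.
Qed.

End Mx2.

(** * Growth in SL2 *)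

Lemma mem_setX (T T' : finType) (A : {set T}) (B : {set T'}) (q : T * T') :
  (q \in setX A B) = (q.1 \in A) && (q.2 \in B).
Proof. by case: q => x y; rewrite in_setX. Qed.

Lemma gen_ind (gT : finGroupType) (A : {set gT}) (P : gT -> Prop) :
  P 1%g -> (forall x a, P x -> a \in A -> P (x * a)%g) -> forall x, x \in <<A>>%g -> P x.
Proof.
move=> P1 PM x /gen_prodgP[n [c cA ->]].
elim: n c cA => [|n IHn] c cA; first by rewrite big_ord0.
by rewrite big_ord_recr; apply: PM => //; apply: IHn.
Qed.

Lemma expg_subset (gT : finGroupType) (A : {set gT}) m n :
  1%g \in A -> (m <= n)%N -> (A ^+ m \subset A ^+ n)%g.
Proof.
move=> A1; elim: n => [|n IHn]; first by rewrite leqn0 => /eqP ->.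
rewrite leq_eqVlt => /orP[/eqP -> //|]; rewrite ltnS => /IHn h.
by apply: subset_trans h _; rewrite expgSr; apply: mulg_subl.
Qed.

Lemma card_gt_subset (T : finType) (A B : {set T}) : (#|B| < #|A|)%N -> exists2 x, x \in A & x \notin B.
Proof.
move=> h; have /subsetPn[x xA xB] : ~~ (A \subset B) by apply/negP => /subset_leq_card; rewrite leqNgt h.
by exists x.
Qed.

(* G is identified with SL2(F) by rho, but stays an abstract group. *)
Record SL2_model (F : finFieldType) (gT : finGroupType) (G : {group gT})
    (rho : gT -> 'M[F]_2) : Prop := SL2Model {
  model_mul : forall x y, rho (x * y)%g = rho x *m rho y;
  model_one : rho 1%g = 1%:M;
  model_inj : injective rho;
  model_det : forall x, x \in G -> \det (rho x) = 1;
  model_full : forall M, \det M = 1 -> exists2 x, x \in G & rho x = M }.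

Section Growth.
Variables (F : finFieldType) (gT : finGroupType) (G : {group gT}) (rho : gT -> 'M[F]_2).
Hypotheses (mod : SL2_model G rho) (n2 : (2 : F) != 0).
Local Notation p := #|F|.
Implicit Types (x y z g h : gT) (v w : 'cV[F]_2) (W A : {set gT}).

Let rhoM := model_mul mod.
Let rho1 := model_one mod.
Let rho_inj := model_inj mod.
Let rho_det := model_det mod.
Let rho_full := model_full mod.

Definition gtr x : F := \tr (rho x).

Lemma rho_eq1 x : rho x = 1%:M -> x = 1%g.
Proof. by rewrite -rho1 => /rho_inj. Qed.

Lemma rhoVK x v : rho (x^-1)%g *m (rho x *m v) = v.
Proof. by rewrite mulmxA -rhoM mulVg rho1 mul1mx. Qed.

Lemma rho_fix2 x y v w : v 0 0 * w 1 0 != v 1 0 * w 0 0 ->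
  rho x *m v = rho y *m v -> rho x *m w = rho y *m w -> x = y.
Proof.
move=> d hv hw; suff /rho_eq1/(congr1 (mulg y)) : rho (y^-1 * x)%g = 1%:M.
  by rewrite mulKVg mulg1.
by apply: eigen_scalar d _ _; rewrite rhoM -mulmxA ?hv ?hw rhoVK scale1r.
Qed.

Lemma not_eigen_indep g v : v != 0 -> ~ eigen (rho g) v ->
  v 0 0 * (rho g *m v) 1 0 != v 1 0 * (rho g *m v) 0 0.
Proof. by move=> v0 h; apply/negP => /eqP /(parallel2 v0) [c hc]; apply: h; exists c. Qed.

Lemma eigenvalue_neq0 x v (c : F) : v != 0 -> rho x *m v = c *: v -> c != 0.
Proof.
move=> v0 h; apply: contraNneq v0 => c0.
by rewrite -(rhoVK x v) h c0 scale0r mulmx0.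
Qed.

Definition tr_slice W (t : F) : {set gT} := [set x in W | gtr x == t].

Section LarsenPink.
Variables (W : {set gT}) (t : F) (b : nat).
Hypotheses (WSL : W \subset G) (t0 : t != 0).
Hypotheses (WWb : (#|(W * W)%g| <= b)%N) (Wb : (#|W| <= b)%N).
Hypothesis escape : forall v, v != 0 -> exists2 g : gT, ~ eigen (rho g) v &
  (#|(W * [set g] * W)%g| <= b)%N.

Let X := tr_slice W t.
Let X3 := setX (setX X X) X.

Let XW x : x \in X -> x \in W.
Proof. by rewrite inE => /andP[]. Qed.

Let Xtr x : x \in X -> gtr x = t.
Proof. by rewrite inE => /andP[_ /eqP]. Qed.

Let Xdet x : x \in X -> \det (rho x) = 1.
Proof. by move/XW/(subsetP WSL)/rho_det. Qed.

Definition common_eigen (q : gT * gT * gT) (c : F * F * F) := [exists v : 'cV[F]_2,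
  [&& v != 0, rho q.1.1 *m v == c.1.1 *: v, rho q.1.2 *m v == c.1.2 *: v
    & rho q.2 *m v == c.2 *: v]].

Let cls (u : gT * (F * F * F)) := [set q in X3 | (q.1.1 == u.1) && common_eigen q u.2].

Lemma card_common_eigen u : ~~ is_scalar_mx (rho u.1) -> (#|cls u| <= b)%N.
Proof.
case: u => x1 c /= nsx1; have ns d : rho x1 != d%:M.
  by apply: contraNneq nsx1 => ->; apply/is_scalar_mxP; exists d.
case: (set_0Vmem (cls (x1, c))) => [->|[q0]]; first by rewrite cards0.
rewrite inE => /andP[q0X /andP[/eqP /= e0 /existsP[v /and4P[v0 /eqP h1 _ _]]]].
rewrite e0 in h1.
have [g ng hb] := escape v0.
have cE q : q \in cls (x1, c) -> [/\ q \in X3, q.1.1 = x1, rho q.1.2 *m v = c.1.2 *: v &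
    rho q.2 *m v = c.2 *: v].
  rewrite inE => /andP[qX /andP[/eqP /= e1 /existsP[w /and4P[w0 /eqP w1 /eqP w2 /eqP w3]]]].
  rewrite e1 in w1.
  have [d dE] := eigen_parallel ns w0 w1 h1; split=> //.
    by rewrite dE -scalemxAr w2 !scalerA mulrC.
  by rewrite dE -scalemxAr w3 !scalerA mulrC.
apply: leq_trans hb.
apply: (@leq_card_in_inj _ _ _ _ (fun q => (q.1.2 * g * q.2)%g)).
  move=> q /cE[]; rewrite !inE => /andP[/andP[_ /andP[h2 _]] /andP[h3 _]] _ _ _.
  by rewrite !mem_mulg ?set11.
move=> [[a1 a2] a3] [[b1 b2] b3] /cE[_ /= -> ha2 ha3] /cE[_ /= -> hb2 hb3] e.
have c0 := eigenvalue_neq0 v0 ha3.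
have e2 : a2 = b2.
  apply: (rho_fix2 (not_eigen_indep v0 ng)); first by rewrite ha2 hb2.
  apply: (scalerI c0); rewrite !scalemxAr -{1}ha3 -hb3 !mulmxA -!rhoM.
  by rewrite e.
by move: e; rewrite e2 => /mulgI ->.
Qed.

Let root2 (l : F) := l ^+ 2 - t * l + 1 == 0.

Let card_roots : (#|[set l : F | root2 l]| <= 2)%N.
Proof.
apply: card_le2 => x y z; rewrite !in_set => hx hy hz.
have aux (a c : F) : root2 a -> root2 c -> a = c \/ a + c = t.
  move=> /eqP ha /eqP hc; have : (a - c) * (a + c - t) == 0.
    apply/eqP; transitivity ((a ^+ 2 - t * a + 1) - (c ^+ 2 - t * c + 1)); first by ring.
    by rewrite ha hc subrr.
  by rewrite mulf_eq0 !subr_eq0 => /orP[]/eqP; [left|right].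
case: (aux x y hx hy) => [|exy]; first by constructor 1.
case: (aux y z hy hz) => [|eyz]; first by constructor 2.
by constructor 3; apply: (@addIr F y); rewrite exy addrC.
Qed.

Let inv_trace x y : x \in X -> y \in X -> \tr (rho x *m (rho x *m rho y)) =
   t * \tr (rho x *m rho y) - t.
Proof.
move=> xX yX.
have e : rho x *m rho x = t *: rho x - 1%:M.
  rewrite -(mulmx_adj2 (Xdet xX)) -/(gtr x) (Xtr xX) mulmxBr mul_mx_scalar.
  by rewrite opprB addrC subrK.
by rewrite mulmxA e mulmxBl -scalemxAl raddfB /= mxtraceZ mul1mx -/(gtr y) (Xtr yX).
Qed.

(* The map (x1, x2, x3) |-> (x1 x2, x1 x3) on triples of X has fibres of size at most 2
   outside the degenerate triples, which are few. *)
Lemma larsen_pink : (#|X| ^ 3 <= 14 * b ^ 2)%N.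
Proof.
pose B1 := [set q in X3 | is_scalar_mx (rho q.1.1)].
pose B2 := [set q in X3 | q.1.1 * q.1.2 == 1]%g.
pose B3 := [set q in X3 | q.1.1 * q.2 == 1]%g.
pose B4 := [set q in X3 | q.1.2 == q.2].
pose U := setX [set x in X | ~~ is_scalar_mx (rho x)]
  (setX (setX [set l : F | root2 l] [set l : F | root2 l])
        [set l : F | root2 l]).
pose B5 := \bigcup_(u in U) cls u.
pose B := B1 :|: B2 :|: B3 :|: B4 :|: B5.
have XX : #|setX X X| = (#|X| ^ 2)%N by rewrite cardsX mulnn.
have X3P q : q \in X3 -> [/\ q.1.1 \in X, q.1.2 \in X & q.2 \in X].
  by rewrite !mem_setX => /andP[/andP[]].
have hB1 : (#|B1| <= #|X| ^ 2)%N.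
  rewrite -XX; apply: (@leq_card_in_inj _ _ _ _ (fun q => (q.1.2, q.2))).
    by move=> q /setIdP[/X3P[h1 h2 h3] _]; rewrite mem_setX h2.
  move=> [[a1 a2] a3] [[b1 b2] b3]; move=> /setIdP[/X3P[/= ha _ _] sa] /setIdP[/X3P[/= hb _ _] sb].
  move=> [-> ->]; congr (_, _, _); apply: rho_inj.
  case/is_scalar_mxP: sa (Xtr ha) => /= c; rewrite /gtr => ->.
  case/is_scalar_mxP: sb (Xtr hb) => /= d; rewrite /gtr => ->.
  by rewrite !mxtrace_scalar -[c *+ 2]mulr_natl -[d *+ 2]mulr_natl => <- /(mulfI n2) ->.
have hB2 : (#|B2| <= #|X| ^ 2)%N.
  rewrite -XX; apply: (@leq_card_in_inj _ _ _ _ (fun q => (q.1.1, q.2))).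
    by move=> q /setIdP[/X3P[h1 h2 h3] _]; rewrite mem_setX h1.
  move=> [[a1 a2] a3] [[b1 b2] b3]; move=> /setIdP[_ /= /eqP sa] /setIdP[_ /= /eqP sb].
  by move=> [e ->]; move: sb; rewrite -sa e => /mulgI ->.
have hB3 : (#|B3| <= #|X| ^ 2)%N.
  rewrite -XX; apply: (@leq_card_in_inj _ _ _ _ (fun q => (q.1.1, q.1.2))).
    by move=> q /setIdP[/X3P[h1 h2 h3] _]; rewrite mem_setX h1.
  move=> [[a1 a2] a3] [[b1 b2] b3]; move=> /setIdP[_ /= /eqP sa] /setIdP[_ /= /eqP sb].
  by move=> [e ->]; move: sb; rewrite -sa e => /mulgI ->.
have hB4 : (#|B4| <= #|X| ^ 2)%N.
  rewrite -XX; apply: (@leq_card_in_inj _ _ _ _ (fun q => (q.1.1, q.1.2))).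
    by move=> q /setIdP[/X3P[h1 h2 h3] _]; rewrite mem_setX h1.
  move=> [[a1 a2] a3] [[b1 b2] b3]; move=> /setIdP[_ /= /eqP sa] /setIdP[_ /= /eqP sb].
  by move=> [-> e]; rewrite -sa -sb e.
have hB5 : (#|B5| <= #|X| * 8 * b)%N.
  apply: leq_trans (leq_card_bigcup (c := b) _) _.
    by move=> u; rewrite mem_setX => /andP[/setIdP[_ h] _]; apply: card_common_eigen.
  rewrite leq_mul2r; apply/orP; right; rewrite cardsX; apply: leq_mul.
    by apply/subset_leq_card/subsetP => x; rewrite in_set => /andP[].
  rewrite !cardsX; exact: (leq_mul (leq_mul card_roots card_roots) card_roots).
have hG : (#|X3 :\: B| <= 2 * b ^ 2)%N.
  rewrite -mulnn; apply: leq_trans (_ : 2 * #|setX (W * W)%g (W * W)%g| <= _)%N; last first.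
    by rewrite leq_mul2l cardsX leq_mul.
  apply: (@leq_card_fibres _ _ _ _ (fun q => (q.1.1 * q.1.2, q.1.1 * q.2)%g)).
    move=> q /setDP[/X3P[/XW h1 /XW h2 /XW h3] _].
    by rewrite mem_setX !mem_mulg.
  move=> [y1 y2] _; apply: card_le2 => q q' q''.
  move=> /setIdP[/setDP[/X3P[q1 q2 q3] qB] /eqP[h1 h2]].
  move=> /setIdP[/setDP[/X3P[q1' q2' q3'] _] /eqP[h1' h2']].
  move=> /setIdP[/setDP[/X3P[q1'' q2'' q3''] _] /eqP[h1'' h2'']].
  have inj (r r' : gT * gT * gT) : (r.1.1 = r'.1.1 -> r.1.1 * r.1.2 = y1 ->
     r.1.1 * r.2 = y2 -> r'.1.1 * r'.1.2 = y1 -> r'.1.1 * r'.2 = y2 -> r = r')%g.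
    case: r r' => [[a1 a2] a3] [[b1 b2] b3] /= -> <- <-.
    by move=> /mulgI -> /mulgI ->.
  case: (eqVneq q.1.1 q'.1.1) => [/inj h|n1]; first by constructor 1; apply: h.
  case: (eqVneq q'.1.1 q''.1.1) => [/inj h|n3]; first by constructor 2; apply: h.
  case: (eqVneq q.1.1 q''.1.1) => [/inj h|n4]; first by constructor 3; apply: h.
  have tw (x y x' y' : gT) : x \in X -> y \in X -> x' \in X -> y' \in X -> (x * y = x' * y')%g ->
      \tr (rho x' *m (rho x *m rho y)) = \tr (rho x *m (rho x *m rho y)).
    move=> xX yX xX' yX' e; rewrite inv_trace // -rhoM e rhoM inv_trace //.
  have q3X : q \in X3 by rewrite !mem_setX q1 q2 q3.
  exfalso; have := @fibre_degenerate _ t (rho q.1.1) (rho q'.1.1) (rho q''.1.1)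
    (rho q.1.2) (rho q.2) t0.
  case; rewrite ?Xdet ?(inj_eq rho_inj) //; try exact: Xtr.
  - by apply: (tw _ _ _ q'.1.2) => //; rewrite h1.
  - by apply: (tw _ _ _ q''.1.2) => //; rewrite h1.
  - by apply: (tw _ _ _ q'.2) => //; rewrite h2.
  - by apply: (tw _ _ _ q''.2) => //; rewrite h2.
  - rewrite -rhoM => /rho_eq1 e.
    have h : q \in B2 by apply/setIdP; split=> //; apply/eqP.
    by case/negP: qB; rewrite !in_setU h !orbT.
  - rewrite -rhoM => /rho_eq1 e.
    have h : q \in B3 by apply/setIdP; split=> //; apply/eqP.
    by case/negP: qB; rewrite !in_setU h !orbT.
  - move=> /rho_inj e.
    have h : q \in B4 by apply/setIdP; split=> //; apply/eqP.
    by case/negP: qB; rewrite !in_setU h !orbT.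
  move=> [v v0 [[l1 hl1] [l2 hl2] [l3 hl3]]].
  case/negP: qB; rewrite 4!in_setU -!orbA; case: (boolP (q \in B1)) => //= nB1.
  apply/or4P; constructor 4; apply/bigcupP; exists (q.1.1, (l1, l2, l3)).
    have root (x : gT) (l : F) : x \in X -> rho x *m v = l *: v -> root2 l.
      move=> xX /(eigen_char v0); rewrite (Xdet xX) -/(gtr x) (Xtr xX) => h.
      by apply/eqP.
    rewrite mem_setX; apply/andP; split.
      by apply/setIdP; split=> //; apply: contra nB1 => h; apply/setIdP.
    by rewrite !mem_setX /= !in_set (root _ _ q1 hl1) (root _ _ q2 hl2) (root _ _ q3 hl3).
  apply/setIdP; split=> //; rewrite eqxx /=; apply/existsP; exists v.
  by rewrite v0 hl1 hl2 hl3 !eqxx.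
have : (#|X3| <= #|X| ^ 2 + #|X| ^ 2 + #|X| ^ 2 + #|X| ^ 2 + #|X| * 8 * b + 2 * b ^ 2)%N.
  rewrite -(cardsID B X3); apply: leq_add => //.
  apply: leq_trans (subset_leq_card (subsetIr _ _)) _.
  by do 4!(apply: leq_trans (leq_card_setU _ _) _; apply: leq_add => //).
have Xb : (#|X| <= b)%N.
  by apply: leq_trans Wb; apply/subset_leq_card/subsetP => x /XW.
have XX2 : (#|X| ^ 2 <= b ^ 2)%N by rewrite leq_exp2r.
have : (#|X| * 8 * b <= 8 * b ^ 2)%N by have := leq_mul Xb (leqnn b); lia.
by rewrite !cardsX; lia.
Qed.
End LarsenPink.

Lemma card_SL2 : (p ^ 3 <= 2 * #|G|)%N.
Proof.
pose D := setX (setX [set a : F | a != 0] [set: F]) [set: F].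
pose f (q : F * F * F) : 'M[F]_2 := \matrix_(i, j)
  if i == 0 then (if j == 0 then q.1.1 else q.1.2) else (if j == 0 then q.2 else (1 + q.1.2 * q.2) / q.1.1).
have p1 : (1 < p)%N := card_finNzRing_gt1 F.
have cD : (p ^ 3 <= 2 * #|D|)%N.
  rewrite !cardsX !cardsT.
  have -> : #|[set a : F | a != 0]| = p.-1.
    have := cardsC [set (0 : F)]; rewrite cards1.
    have -> : ~: [set (0 : F)] = [set a : F | a != 0] by apply/setP => a; rewrite !inE.
    by move=> <-.
  move: p p1 => n n1; have : (n <= 2 * n.-1)%N by lia.
  by move/(leq_mul (leqnn (n * n))); nia.
apply: leq_trans cD _; rewrite leq_mul2l /=.
have fS : f @: D \subset rho @: G.
  apply/subsetP => M /imsetP[q]; rewrite !mem_setX !in_set !andbT => q0 ->.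
  have [|x xS xE] := @rho_full (f q); first by rewrite !mx2E /=; field.
  by apply/imsetP; exists x.
apply: leq_trans (leq_trans (subset_leq_card fS) (leq_imset_card _ _)).
rewrite card_in_imset // => -[[a b] c] [[a' b'] c'] _ _ /matrixP e.
by have := e 0 0; have := e 0 1; have := e 1 0; rewrite !mxE /= => -> -> ->.
Qed.

Lemma SL2_no_eigen v : v != 0 -> exists2 x, x \in G & ~ eigen (rho x) v.
Proof.
move=> v0.
have [|x xS xE] := @rho_full (\matrix_(i, j) ((i == j) || (j == 1))%:R); first by rewrite !mx2E /=; ring.
have [|y yS yE] := @rho_full (\matrix_(i, j) ((i == j) || (i == 1))%:R); first by rewrite !mx2E /=; ring.
case: (eqVneq (v 1 0) 0) => v1.
  exists y => // -[c]; rewrite yE => /colP h; have := h 0; have := h 1.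
  rewrite !mx2E /= v1 !mul1r mulr0 addr0 mul0r addr0 => h1 _.
  by case/eqP: v0; apply: cV2_eq; rewrite !mxE.
exists x => // -[c]; rewrite xE => /colP h; have := h 1; have := h 0.
rewrite !mx2E /= !mul1r mul0r add0r => h0 h1.
have c1 : c = 1 by apply: (mulIf v1); rewrite mul1r -h1.
by case/eqP: v1; move: h0; rewrite c1 mul1r => /eqP; rewrite addrC -subr_eq0 addrK => /eqP.
Qed.

Lemma rho_commute x y : x \in 'C[y]%g -> rho x *m rho y = rho y *m rho x.
Proof. by move/cent1P => h; rewrite -!rhoM h. Qed.

Lemma gtrJ x h : gtr (x ^ h)%g = gtr x.
Proof. by rewrite /gtr conjgE !rhoM mxtrace_mulC -mulmxA -rhoM mulgV rho1 mulmx1. Qed.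

Lemma card_torus_slice g (t : F) : g \in G -> (gtr g) ^+ 2 != 4 ->
  (#|tr_slice 'C_G[g]%g t| <= 2)%N.
Proof.
move=> gS tg; apply: card_le2 => x y z.
move=> /setIdP[/setIP[xS xC] /eqP xt] /setIdP[/setIP[yS yC] /eqP yt] /setIdP[/setIP[zS zC] /eqP zt].
case: (@torus_trace _ (rho g) (rho x) (rho y) (rho z) n2 _ tg);
  rewrite -/(gtr _) ?rho_det ?xt ?yt ?zt //; try exact: rho_commute.
- by move=> e; constructor 1; apply: rho_inj.
- by move=> e; constructor 2; apply: rho_inj.
by move=> e; constructor 3; apply: rho_inj.
Qed.

Lemma card_torus g : g \in G -> (gtr g) ^+ 2 != 4 -> (#|'C_G[g]%g| <= 2 * p)%N.
Proof.
move=> gS tg; rewrite -[X in (_ <= 2 * X)%N]cardsT.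
by apply: (@leq_card_fibres _ _ _ _ gtr) => // t _; apply: card_torus_slice.
Qed.

Variables (A : {set gT}) (b : nat).
Hypotheses (AS : A \subset G) (A1 : 1%g \in A) (AV : (A^-1)%g = A) (Agen : <<A>>%g = G).
Hypothesis (Ab : (#|(A ^+ 9)%g| <= b)%N).

Let Asub n : (A ^+ n)%g \subset G.
Proof.
elim: n => [|n IHn]; first by rewrite expg0 sub1set group1.
by rewrite expgSr; apply: mul_subG.
Qed.

Let Aexp n : (n <= 9)%N -> (#|(A ^+ n)%g| <= b)%N.
Proof. by move=> h; apply: leq_trans Ab; apply/subset_leq_card/expg_subset. Qed.

Let Vin x : (x^-1 \in A)%g = (x \in A).
Proof. by rewrite -{2}AV mem_invg. Qed.

Let A2V x y : x \in A -> y \in A -> (x^-1 * y)%g \in (A ^+ 2)%g.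
Proof. by move=> xA yA; rewrite expgS expg1 mem_mulg ?Vin. Qed.

Lemma growth_slice (t : F) : t != 0 -> (#|tr_slice (A ^+ 4)%g t| ^ 3 <= 14 * b ^ 2)%N.
Proof.
move=> t0; apply: (larsen_pink (Asub 4) t0).
- by rewrite -expgD; apply: Aexp.
- exact: Aexp.
move=> v v0.
suff [g gA ng] : exists2 g, g \in A & ~ eigen (rho g) v.
  exists g => //; apply: leq_trans (@Aexp 9 isT); apply: subset_leq_card.
  by rewrite (expgD A 5 4) (expgSr A 4) !mulgSS ?sub1set.
have [x xS nx] := SL2_no_eigen v0.
have eP g : reflect (eigen (rho g) v) [exists c : F, rho g *m v == c *: v].
  by apply: (iffP existsP) => [[c /eqP h]|[c h]]; exists c => //; apply/eqP.
case: (boolP [exists g in A, ~~ [exists c : F, rho g *m v == c *: v]]).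
  by case/exists_inP => g gA /eP ng; exists g.
rewrite negb_exists_in => /forall_inP h; case: nx.
rewrite -Agen in xS; move: x xS; apply: gen_ind.
  by exists 1; rewrite rho1 mul1mx scale1r.
move=> x a [c hc] /h; rewrite negbK => /eP [d hd].
by exists (d * c); rewrite rhoM -mulmxA hd -scalemxAr hc scalerA.
Qed.

(* Otherwise four traceless elements with traceless pairwise products can be chosen in turn. *)
Lemma regular_element : (8 ^ 3 * (14 * b ^ 2) < #|A| ^ 3)%N ->
  exists2 g, g \in (A ^+ 2)%g & (gtr g != 0) && ((gtr g) ^+ 2 != 4).
Proof.
move=> hN.
pose Y := tr_slice (A ^+ 2)%g 2 :|: tr_slice (A ^+ 2)%g (-2).
have hY : (4 * #|Y| < #|A|)%N.
  have slice t : t != 0 -> (8 * #|tr_slice (A ^+ 2)%g t| < #|A|)%N.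
    move=> t0; rewrite -(@ltn_exp2r _ _ 3) //; apply: leq_ltn_trans hN.
    rewrite expnMn leq_mul2l; apply/orP; right; apply: leq_trans (growth_slice t0).
    rewrite leq_exp2r //; apply/subset_leq_card/subsetP => x /setIdP[xA xt].
    by apply/setIdP; split=> //; apply: (subsetP (expg_subset _ _)) xA.
  have n2N : (-2 : F) != 0 by rewrite oppr_eq0.
  have aux (y n u w : nat) : (8 * u < n -> 8 * w < n -> y <= u + w -> 4 * y < n)%N by lia.
  exact: aux (slice _ n2) (slice _ n2N) (leq_card_setU _ _).
case: (boolP [exists g in (A ^+ 2)%g, (gtr g != 0) && ((gtr g) ^+ 2 != 4)]).
  by case/exists_inP => g; exists g.
rewrite negb_exists_in => /forall_inP h.
have t0 x : x \in (A ^+ 2)%g -> x \notin Y -> gtr x = 0.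
  move=> xA; rewrite /Y !in_set xA /= negb_or => /andP[h1 h2].
  apply/eqP; move: (h x xA); rewrite negb_and !negbK => /orP[//|].
  rewrite (_ : 4 = 2 ^+ 2); last by ring.
  by rewrite eqf_sqr (negbTE h1) (negbTE h2).
have A2 x : x \in A -> x \in (A ^+ 2)%g by apply: (subsetP (@expg_subset _ A 1 2 A1 isT)).
have A2M x y : x \in A -> y \in A -> (x * y)%g \in (A ^+ 2)%g by move=> xA yA; rewrite expgS expg1 mem_mulg.
have cY x : #|(x^-1 *: Y)%g| = #|Y| by rewrite card_lcoset.
have step x y : x \in A -> y \in A -> y \notin (x^-1 *: Y)%g -> \tr (rho x *m rho y) = 0.
  by move=> xA yA; rewrite mem_lcoset invgK => /(t0 _ (A2M _ _ xA yA)); rewrite /gtr rhoM.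
have cU (B : {set gT}) x m : (#|B| <= m * #|Y|)%N -> (#|B :|: (x^-1 *: Y)%g| <= m.+1 * #|Y|)%N.
  move=> hB; rewrite mulSnr; apply: leq_trans (leq_card_setU _ _) _.
  by apply: leq_add; rewrite ?cY.
have lt (B : {set gT}) m : (#|B| <= m * #|Y|)%N -> (m <= 4)%N -> (#|B| < #|A|)%N.
  by move=> hB hm; apply: leq_ltn_trans hB (leq_ltn_trans _ hY); rewrite leq_mul2r hm orbT.
have c1 : (#|Y| <= 1 * #|Y|)%N by rewrite mul1n.
have [x1 x1A n1] := card_gt_subset (lt _ _ c1 isT).
have c2 := cU _ x1 _ c1; have [x2 x2A] := card_gt_subset (lt _ _ c2 isT).
rewrite in_setU negb_or => /andP[n2' n12].
have c3 := cU _ x2 _ c2; have [x3 x3A] := card_gt_subset (lt _ _ c3 isT).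
rewrite 2!in_setU 2!negb_or => /andP[/andP[n3 n13] n23].
have c4 := cU _ x3 _ c3; have [x4 x4A] := card_gt_subset (lt _ _ c4 isT).
rewrite 3!in_setU 3!negb_or => /andP[/andP[/andP[n4 n14] n24] n34].
exfalso; apply: (@no_orthogonal4 _ (fun i : 'I_4 => rho (nth 1%g [:: x1; x2; x3; x4] i)) n2).
- by case=> [[|[|[|[|//]]]] hi] /=; apply: t0 => //; apply: A2.
- by case=> [[|[|[|[|//]]]] hi] /=; apply: rho_det; apply: (subsetP AS).
by case=> [[|[|[|[|//]]]] hi] [[|[|[|[|//]]]] hj] //= _; apply: step.
Qed.

Lemma torus_large g : g \in (A ^+ 2)%g -> gtr g != 0 ->
  (#|A| ^ 3 <= #|(A ^+ 2 :&: 'C[g])%g| ^ 3 * (14 * b ^ 2))%N.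
Proof.
move=> gA tg.
have h : (#|A| <= #|(A ^+ 2 :&: 'C[g])%g| * #|tr_slice (A ^+ 4)%g (gtr g)|)%N.
  apply: (@leq_card_fibres _ _ _ _ (fun a => g ^ a^-1)%g).
    move=> a aA; apply/setIdP; split; last by rewrite gtrJ.
    rewrite conjgE invgK mulgA (expgD A 3 1) expg1 mem_mulg ?Vin //.
    by rewrite (expgS A 2) mem_mulg.
  move=> y _; case: (set_0Vmem [set a in A | (g ^ a^-1)%g == y]) => [->|[a0]]; first by rewrite cards0.
  move=> /setIdP[a0A /eqP e0]; rewrite -(card_lcoset [set a in A | (g ^ a^-1)%g == y] a0^-1%g).
  apply/subset_leq_card/subsetP => x; rewrite mem_lcoset invgK => /setIdP[xA /eqP ex].
  apply/setIP; split; first by rewrite -(mulKg a0 x) A2V.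
  rewrite -e0 in ex; apply/cent1P; rewrite /commute; apply/esym/commgP/conjg_fixP.
  by have := congr1 (fun z => z ^ (a0 * x))%g ex; rewrite -!conjgM mulVg conjg1 mulKg.
apply: leq_trans (_ : (#|(A ^+ 2 :&: 'C[g])%g| * #|tr_slice (A ^+ 4)%g (gtr g)|) ^ 3 <= _)%N.
  by rewrite leq_exp2r.
by rewrite expnMn leq_mul2l growth_slice // orbT.
Qed.

Definition involved g := [&& g \in G, (gtr g) ^+ 2 != 4 & (6 < #|(A ^+ 2 :&: 'C[g])%g|)%N].

Lemma involved_card g : involved g ->
  (#|A| ^ 3 <= #|(A ^+ 2 :&: 'C[g])%g| ^ 3 * (14 * b ^ 2))%N.
Proof.
case/and3P => gS tg h6.
pose T := 'C_G[g]%g.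
have hT : (#|tr_slice T 0%R :|: tr_slice T 2%R :|: tr_slice T (-2)%R| <= 6)%N.
  apply: leq_trans (leq_card_setU _ _) _; apply: (@leq_add _ _ 4%N 2%N).
    apply: leq_trans (leq_card_setU _ _) _.
    exact: (leq_add (card_torus_slice _ gS tg) (card_torus_slice _ gS tg)).
  exact: card_torus_slice.
have [g' /setIP[g'A g'C]] := card_gt_subset (leq_ltn_trans hT h6).
have g'S : g' \in G by apply: (subsetP (Asub 2)).
have g'T : g' \in T by rewrite inE g'S.
have nt t : g' \notin tr_slice T t -> gtr g' != t.
  by apply: contra => e; apply/setIdP.
rewrite 2!in_setU 2!negb_or => /andP[/andP[/nt n0 /nt m2] /nt m2'].
have ns d : rho g != d%:M.
  by apply: contraNneq tg => e; move: (rho_det gS); rewrite /gtr e => /scalar_trace ->.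
have [a [c eg']] := commute_span ns (rho_commute g'C).
have c0 : c != 0.
  apply: contraNneq m2 => c0; move: (rho_det g'S) m2'; rewrite /gtr eg' c0 scale0r addr0.
  move/scalar_trace; rewrite (_ : 4 = 2 ^+ 2); last by ring.
  by move/eqP; rewrite eqf_sqr => /orP[->|->].
apply: leq_trans (torus_large g'A n0) _.
rewrite leq_mul2r leq_exp2r //; apply/orP; right; apply/subset_leq_card/subsetP => x.
move=> /setIP[xA xC]; apply/setIP; split=> //.
have := rho_commute xC; rewrite eg' mulmxDl mulmxDr -scalar_mxC => /addrI.
rewrite -scalemxAl -scalemxAr => /(scalerI c0) e.
by apply/cent1P/rho_inj; rewrite rhoM e -rhoM.
Qed.

Hypothesis hN : (216 * (14 * b ^ 5) < #|A| ^ 6)%N.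

(* Pivoting: A^4 meets the conjugate torus in many elements, and if A^2 met it in few,
   then their products with A would overflow A^5. *)
Lemma involvedJ g a : involved g -> a \in A -> involved (g ^ a)%g.
Proof.
move=> ig aA; have h3 := involved_card ig; case/and3P: ig => gS tg h6.
have aS : a \in G by apply: (subsetP AS).
rewrite /involved gtrJ tg groupJ //=; rewrite ltnNge; apply/negP => h.
set m := #|(A ^+ 2 :&: 'C[g])%g| in h3 h6.
have hm : (#|A| * m <= 6 * b)%N.
  apply: leq_trans (_ : #|(A ^+ 2 :&: 'C[g ^ a])%g| * #|(A ^+ 5)%g| <= _)%N; last first.
    by apply: leq_mul h (Aexp _).
  have -> : m = #|(A ^+ 2 :&: 'C[g])%g :^ a|%g by rewrite cardJg.
  rewrite -cardsX; apply: (@leq_card_fibres _ _ _ _ (fun q => q.1 * q.2)%g).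
    move=> q; rewrite mem_setX => /andP[q1 /imsetP[z /setIP[zA _] ->]].
    rewrite (expgS A 4) mem_mulg // conjgE (expgS A 3) mem_mulg ?Vin //.
    by rewrite (expgSr A 2) mem_mulg.
  move=> y _; pose Q := [set q in setX A ((A ^+ 2 :&: 'C[g])%g :^ a)%g | (q.1 * q.2)%g == y].
  rewrite -/Q; case: (set_0Vmem Q) => [->|[q0]]; first by rewrite cards0.
  case/setIdP; rewrite mem_setX => /andP[q0A q0C] /eqP e0.
  have CJ z : z \in ((A ^+ 2 :&: 'C[g])%g :^ a)%g -> z \in ('C[g ^ a])%g.
    by rewrite cent1J; apply/subsetP; rewrite conjSg subsetIr.
  apply: (@leq_card_in_inj _ _ _ _ (fun q : gT * gT => q0.1^-1 * q.1)%g).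
    move=> q /setIdP[]; rewrite mem_setX => /andP[qA qC] /eqP e.
    apply/setIP; split; first exact: A2V.
    have -> : (q0.1^-1 * q.1 = q0.2 * q.2^-1)%g.
      by apply: (mulgI q0.1); apply: (mulIg q.2); rewrite mulKVg mulgA mulgKV e0 e.
    by rewrite groupM ?groupV ?CJ.
  move=> [q1 q2] [r1 r2] /setIdP[_ /eqP /= e] /setIdP[_ /eqP /= e'] /= /mulgI eqr.
  by move: e'; rewrite -e -eqr => /mulgI ->.
have : (#|A| ^ 6 <= 216 * (14 * b ^ 5))%N.
  rewrite (expnD _ 3 3); apply: leq_trans (leq_mul (leqnn _) h3) _.
  rewrite mulnA -expnMn; apply: leq_trans (leq_mul (_ : _ <= (6 * b) ^ 3)%N (leqnn _)) _.
    by rewrite leq_exp2r.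
  by rewrite expnMn; lia.
by rewrite leqNgt hN.
Qed.

Lemma involved_conj g h : involved g -> h \in G -> involved (g ^ h)%g.
Proof.
move=> ig; rewrite -Agen; move: h; apply: gen_ind; first by rewrite conjg1.
by move=> x a ix aA; rewrite conjgM; apply: involvedJ.
Qed.

Let regular x := (gtr x) ^+ 2 != 4.

Lemma regular_torus_card g : involved g ->
  (#|(A ^+ 2 :&: 'C[g])%g| <= 3 * #|[set x in (A ^+ 2 :&: 'C[g])%g | regular x]|)%N.
Proof.
case/and3P=> gS tg h6; set R := [set x in _ | _]; pose T := 'C_G[g]%g.
have hT : (#|tr_slice T 2%R :|: tr_slice T (-2)%R| <= 4)%N.
  apply: leq_trans (leq_card_setU _ _) _.
  exact: (leq_add (card_torus_slice _ gS tg) (card_torus_slice _ gS tg)).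
suff : (#|(A ^+ 2 :&: 'C[g])%g| <= #|R| + 4)%N by lia.
apply: leq_trans (leq_add (leqnn _) hT); apply: leq_trans (leq_card_setU _ _).
apply/subset_leq_card/subsetP => x xAC; apply/setUP; case: (boolP (x \in R)) => [|nR]; first by left.
right; have : (gtr x) ^+ 2 == 2 ^+ 2.
  rewrite (_ : 2 ^+ 2 = 4); last by ring.
  by apply: contraNT nR => e; apply/setIdP.
case/setIP: xAC => xA xC; have xT : x \in T by rewrite inE (subsetP (Asub 2)).
by rewrite eqf_sqr => /orP[] e; apply/setUP; [left|right]; apply/setIdP.
Qed.

Lemma card_conj_tori g x : g \in G -> (gtr g) ^+ 2 != 4 -> x \in G -> regular x ->
  (#|[set h in G | x \in 'C[g ^ h]%g]| <= 4 * p)%N.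
Proof.
move=> gS tg xS tx; rewrite (_ : 4 * p = 2 * p * 2)%N; last by lia.
apply: leq_trans (leq_mul (leqnn _) (card_torus_slice (gtr x) gS tg)).
apply: (@leq_card_fibres _ _ _ _ (fun h => x ^ h^-1)%g).
  move=> h /setIdP[hS xC]; apply/setIdP; split; last by rewrite gtrJ.
  apply/setIP; split; first by rewrite groupJ ?groupV.
  by rewrite -(mem_conjg _ h) -cent1J.
move=> y _; case: (set_0Vmem [set h in [set h in G | x \in 'C[g ^ h]%g] | (x ^ h^-1)%g == y]).
  by move=> ->; rewrite cards0.
move=> [h0 /setIdP[/setIdP[h0S _] /eqP e0]]; apply: leq_trans (card_torus xS tx).
apply: (@leq_card_in_inj _ _ _ _ (fun h => h0^-1 * h)%g); last by move=> ? ? _ _ /mulgI.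
move=> h /setIdP[/setIdP[hS _] /eqP e]; apply/setIP; split; first by rewrite groupM ?groupV.
rewrite -e in e0; apply/cent1P; rewrite /commute; apply/esym/commgP/conjg_fixP.
by have := congr1 (fun z => z ^ h)%g e0; rewrite -!conjgM mulVg conjg1.
Qed.

Lemma involved_growth g : involved g -> (p ^ 6 * #|A| ^ 3 <= 8 * (12 ^ 3 * 14) * b ^ 5)%N.
Proof.
move=> ig; have [gS tg _] := and3P ig.
pose R h := [set x in (A ^+ 2 :&: 'C[g ^ h])%g | regular x].
case: (@arg_minnP _ 1%g (mem G) (fun h => #|(A ^+ 2 :&: 'C[g ^ h])%g|) (group1 _)) => h0 h0S hmin.
set m := #|(A ^+ 2 :&: 'C[g ^ h0])%g| in hmin.
have h1 : (#|G| * m <= 12 * p * b)%N.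
  apply: leq_trans (_ : 3 * \sum_(h in G) #|R h| <= _)%N.
    rewrite -sum_nat_const big_distrr; apply: leq_sum => h hS /=.
    by apply: leq_trans (hmin h hS) _; apply/regular_torus_card/involved_conj.
  rewrite -!mulnA (_ : 12 * (p * b) = 3 * (b * (4 * p)))%N ?leq_mul2l /=; last by lia.
  apply: leq_trans (leq_mul (@Aexp 2 isT) (leqnn _)); rewrite -sum_nat_const.
  have -> : (\sum_(h in G) #|R h| = \sum_(x in (A ^+ 2)%g)
      #|[set h in G | (x \in 'C[g ^ h]%g) && (regular x)]|)%N.
    transitivity (\sum_(h in G) \sum_(x in (A ^+ 2)%g) ((x \in 'C[g ^ h]%g) && (regular x)))%N.
      apply: eq_bigr => h _; rewrite -(card_sum_bool _ (fun x => (x \in 'C[g ^ h]%g) && (regular x))).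
      by congr #|pred_of_set _|; apply/setP => x; rewrite !in_set andbA.
    by rewrite exchange_big; apply: eq_bigr => x _; rewrite card_sum_bool.
  apply: leq_sum => x /(subsetP (Asub 2)) xS.
  case: (boolP (regular x)) => tx.
    by under eq_finset => h do rewrite andbT; apply: card_conj_tori.
  by under eq_finset => h do rewrite andbF andbF; rewrite -/set0 cards0.
have h2 := involved_card (involved_conj ig h0S); rewrite -/m in h2.
have h3 := card_SL2.
have p0 : (0 < p ^ 3)%N by rewrite expn_gt0 (ltnW (card_finNzRing_gt1 F)).
rewrite -(leq_pmul2l p0) mulnA -expnD.
apply: leq_trans (_ : (2 * #|G|) ^ 3 * (m ^ 3 * (14 * b ^ 2)) <= _)%N.
  by rewrite (expnM p 3 3); apply: leq_mul => //; rewrite leq_exp2r.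
rewrite expnMn -mulnA (mulnA (#|G| ^ 3)%N) -(expnMn #|G|).
apply: (@leq_trans (2 ^ 3 * ((12 * p * b) ^ 3 * (14 * b ^ 2)))).
  by rewrite leq_mul2l leq_mul2r leq_exp2r // h1 !orbT.
rewrite !expnMn; lia.
Qed.

End Growth.

Theorem growth (F : finFieldType) (gT : finGroupType) (G : {group gT}) (rho : gT -> 'M[F]_2)
    (A : {set gT}) (b : nat) :
  SL2_model G rho -> (2 : F) != 0 ->
  A \subset G -> 1%g \in A -> (A^-1)%g = A -> <<A>>%g = G -> (#|(A ^+ 9)%g| <= b)%N ->
  [\/ (#|A| ^ 3 <= 8 ^ 3 * (14 * b ^ 2))%N, (#|A| ^ 6 <= 216 * (14 * b ^ 5))%N
   | (#|F| ^ 6 * #|A| ^ 3 <= 8 * (12 ^ 3 * 14) * b ^ 5)%N].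
Proof.
move=> mod n2 AS A1 AV Agen Ab.
case: (leqP (#|A| ^ 3) (8 ^ 3 * (14 * b ^ 2))) => [|h3]; first by constructor 1.
case: (leqP (#|A| ^ 6) (216 * (14 * b ^ 5))) => [|h6]; first by constructor 2.
constructor 3.
have [g gA /andP[g0 tg]] := regular_element mod n2 AS A1 Agen Ab h3.
apply: (involved_growth mod n2 AS A1 AV Agen Ab h6 (g := g)).
have gS : g \in G by apply: subsetP gA; rewrite expgS expg1 mul_subG.
rewrite /involved gS tg /= ltnNge; apply/negP => m6.
have := torus_large mod n2 AS A1 AV Agen Ab gA g0.
rewrite leqNgt => /negP; apply; apply: leq_ltn_trans h3; rewrite leq_mul2r; apply/orP; right.
by apply: leq_trans (_ : 6 ^ 3 <= _)%N; rewrite ?leq_exp2r.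
Qed.

Section Flattening.

Local Open Scope nat_scope.

Lemma popular_subset (gT : finGroupType) (A : {set gT}) (G : {group gT}) L :
  A != set0 -> A \subset G -> popular (A^-1)%g L \subset G.
Proof.
move=> A0 AG; apply/subsetP => x; rewrite inE card_invg => h.
have : 0 < rep (A^-1)%g x.
  by rewrite lt0n; apply: contraTneq h => ->; rewrite muln0 -ltnNge card_gt0.
rewrite card_gt0 => /set0Pn[a]; rewrite in_setI mem_lcoset !mem_invg => /andP[aA xaA].
have aG : a \in G by rewrite -groupV (subsetP AG).
by have := subsetP AG _ xaA; rewrite groupV groupMr // groupV.
Qed.

Lemma absorb c1 c2 m n k x : c1 * c2 <= m -> x <= c1 * (c2 * (n * k)) -> x <= m * n * k.
Proof.
move=> hc /leq_trans; apply; rewrite !mulnA -!(mulnA _ n k) leq_mul2r hc orbT //.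
Qed.

(* The exponent depends neither on the group nor on K, so that K may be a small power of #|F|. *)
Theorem flattening : exists e : nat, forall (F : finFieldType) (gT : finGroupType)
    (G : {group gT}) (rho : gT -> 'M[F]_2) (S : {set gT}) (K : nat),
  SL2_model G rho -> (2 != 0 :> F)%R ->
  1 < K -> S \subset G -> 0 < #|S| -> #|S| ^ 3 <= K * energy S ->
  [\/ exists (H : {group gT}) g,
        [/\ H \proper G, g \in G & #|S| <= K ^ e * #|S :&: (g *: H)%g|],
      #|S| <= K ^ e | #|F| ^ 3 <= K ^ e * #|S|].
Proof.
have [e [e38 e1325 e3235 e1669]] : exists e, [/\ 38 <= e, 1325 <= e, 3235 <= e & 1669 <= e].
  by exists 3235.
exists e => F gT G rho S K mod n2 K1 SS S0 hE.
have K0 : 0 < K by apply: ltnW.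
have Kle m n : m <= n -> K ^ m <= K ^ n by rewrite leq_exp2l.
have two n : 2 ^ n <= K ^ n by case: n => // n; rewrite leq_exp2r.
have [A [AS hSA hAA]] := bsg K1 S0 hE.
have A0 : 0 < #|A| by case: (posnP #|A|) hSA => // ->; rewrite muln0 leqNgt S0.
have ASL := subset_trans AS SS.
pose D := popular (A^-1)%g (2 * K ^ 33).
have h34 : 2 * K ^ 33 <= K ^ 34 by rewrite (expnS K 33) leq_mul2r K1 orbT.
have hAD : #|A| <= K ^ 34 * #|D|.
  by apply: leq_trans (popular_card_ge A0 hAA) _; rewrite leq_mul2r h34 orbT.
have [a aA hAaD] := popular_coset A0 hAA; rewrite -/D in hAaD.
have DSL : D \subset G by apply: popular_subset; rewrite // -card_gt0.
have h67 : 2 * (K ^ 33) ^ 2 <= K ^ 67.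
  by rewrite -expnM (expnS K 66) leq_mul2r K1 orbT.
have D9 : #|(D ^+ 9)%g| <= K ^ 637 * #|D|.
  apply: leq_trans (card_popular_exp A0 hAA 9) _.
  apply: leq_trans (leq_mul (_ : _ <= K ^ 603) hAD) _.
    by rewrite (expnM K 67 9) leq_exp2r.
  by rewrite mulnA -expnD.
have DA : #|D| <= K ^ 67 * #|A|.
  by have := card_popular_exp A0 hAA 1; rewrite expg1 expn1 => /leq_trans; apply; rewrite leq_mul2r h67 orbT.
have D1 : 1%g \in D by apply: one_popular; rewrite muln_gt0 expn_gt0 K0.
have DV : (D^-1)%g = D by apply: popularV.
have SD : #|S| <= K ^ 38 * #|D|.
  apply: leq_trans hSA _; apply: leq_trans (leq_mul (leqnn _) hAD) _.
  by rewrite mulnA -expnD.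
clearbody D.
have [Dgen|Dprop] : <<D>>%g = G \/ <<D>>%g \proper G.
- by case: (eqVneq <<D>>%g (G : {set gT})) => h; [left|right; rewrite properEneq h gen_subG].
- have N0 : 0 < #|D| by case: (posnP #|D|) SD => // ->; rewrite muln0 leqNgt S0.
  have [b [{}D9 bE]] : exists b, #|(D ^+ 9)%g| <= b /\ forall n, b ^ n = K ^ (637 * n) * #|D| ^ n.
    by exists (K ^ 637 * #|D|); split=> // n; rewrite expnMn -expnM.
  have c1 : 8 ^ 3 * 14 <= K ^ 13 by apply: leq_trans (two 13).
  have c2 : 216 * 14 <= K ^ 12 by apply: leq_trans (two 12).
  have c3 : 8 * (12 ^ 3 * 14) <= K ^ 18.
    by apply: leq_trans (two 18); rewrite (expnD 2 3 15); apply: leq_mul.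
  have {SD} SD n : #|D| <= K ^ n -> 38 + n <= e -> #|S| <= K ^ e.
    move=> h he; apply: leq_trans SD _; apply: leq_trans (leq_mul (leqnn _) h) _.
    by rewrite -expnD Kle.
  have gr := growth mod n2 DSL D1 DV Dgen D9.
  move: gr N0 SD DA (bE 2) (bE 5); move: (#|D|) => N [] h N0 SD DA b2 b5.
  + constructor 2; apply: SD e1325; rewrite -(@leq_pmul2r (N ^ 2)) ?expn_gt0 ?N0 // -expnS.
    by rewrite (expnD K 13 1274); apply: absorb c1 _; rewrite -b2.
  + constructor 2; apply: SD e3235; rewrite -(@leq_pmul2r (N ^ 5)) ?expn_gt0 ?N0 // -expnS.
    by rewrite (expnD K 12 3185); apply: absorb c2 _; rewrite -b5.
  constructor 3; rewrite -(@leq_exp2r _ _ 2) // -expnM.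
  apply: leq_trans (_ : K ^ (18 + 3185) * N ^ 2 <= _).
    rewrite -(@leq_pmul2r (N ^ 3)) ?expn_gt0 ?N0 //; apply: leq_trans h _.
    rewrite b5 -[X in _ <= X]mulnA -(expnD N) mulnA leq_mul2r (expnD K 18) leq_mul2r.
    by apply/orP; right; apply/orP; right.
  have DS : N <= K ^ 67 * #|S| by apply: leq_trans DA _; rewrite leq_mul2l (subset_leq_card AS) orbT.
  apply: leq_trans (leq_mul (leqnn _) (_ : _ <= (K ^ 67 * #|S|) ^ 2)) _; first by rewrite leq_exp2r.
  rewrite (expnMn (K ^ 67)) (expnMn (K ^ e)) mulnA leq_mul2r -(expnM K 67) -(expnM K e).
  rewrite -(expnD K (18 + 3185)); apply/orP; right; apply: Kle.
  by apply: leq_trans (_ : 1669 * 2 <= _); rewrite ?leq_mul2r.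
constructor 1; exists <<D>>%G, a; split=> //; first exact: (subsetP ASL).
apply: leq_trans hSA _; apply: leq_trans (leq_mul (leqnn _) hAaD) _.
rewrite mulnA; apply: leq_mul.
  apply: leq_trans (leq_mul (leqnn _) h34) _; rewrite -expnD; exact: Kle.
by apply/subset_leq_card/setISS => //; rewrite mulgS // subset_gen.
Qed.

End Flattening.

(** * Incidences *)

Lemma sum_sqr_ler (R : realDomainType) (I : finType) (P : pred I) (f : I -> R) :
  (\sum_(i | P i) f i) ^+ 2 <= #|P|%:R * \sum_(i | P i) f i ^+ 2.
Proof.
have : 0 <= \sum_(i | P i) \sum_(j | P j) (f i - f j) ^+ 2.
  by apply: sumr_ge0 => i _; apply: sumr_ge0 => j _; apply: sqr_ge0.
have -> : \sum_(i | P i) \sum_(j | P j) (f i - f j) ^+ 2 =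
    2 * (#|P|%:R * \sum_(i | P i) f i ^+ 2 - (\sum_(i | P i) f i) ^+ 2).
  have e i : \sum_(j | P j) (f i - f j) ^+ 2 =
      #|P|%:R * f i ^+ 2 - 2 * f i * (\sum_(j | P j) f j) + \sum_(j | P j) f j ^+ 2.
    rewrite (eq_bigr (fun j => f i ^+ 2 - 2 * f i * f j + f j ^+ 2)) => [|j _]; last by ring.
    by rewrite big_split /= sumrB sumr_const -mulr_sumr -[_ *+ #|_|]mulr_natl.
  under eq_bigr => i _ do rewrite e.
  rewrite big_split /= sumrB sumr_const -!mulr_sumr -mulr_suml -mulr_sumr -[_ *+ #|_|]mulr_natl.
  by ring.
by rewrite pmulr_rge0 // subr_ge0.
Qed.

Section Incidence.
Variable p : nat.
Hypothesis pr : prime p.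
Local Notation F := 'F_p.
Local Notation V := 'cV['F_p]_2.
Implicit Types (a b c : V) (t s : F).

Definition det2 a b : F := a 0 0 * b 1 0 - a 1 0 * b 0 0.

Lemma det2_eq0 a b : a != 0 -> det2 a b = 0 -> exists d, b = d *: a.
Proof.
by move=> a0 /eqP; rewrite subr_eq0 => /eqP; apply: parallel2.
Qed.

Lemma det2Z s a b : det2 (s *: a) b = s * det2 a b.
Proof. by rewrite /det2 !mxE; ring. Qed.

Lemma det2_mul (m : 'M[F]_2) a b : det2 (m *m a) (m *m b) = \det m * det2 a b.
Proof. by rewrite /det2 !mx2E; ring. Qed.

Lemma card_parallel (B : {set V}) k c : line_bound B k -> c != 0 ->
  (#|[set a in B | det2 c a == 0%R]| <= k)%N.
Proof.
move=> hB c0; apply: leq_trans (hB <[c]>%VS _); last by rewrite dim_vline c0.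
apply/subset_leq_card/subsetP => a /setIdP[aB /eqP /(det2_eq0 c0)[d e]].
by apply/setIdP; split=> //; rewrite e memvZ ?memv_line.
Qed.

Lemma line_boundW (B C : {set V}) k : B \subset C -> line_bound C k -> line_bound B k.
Proof.
move=> BC hC L hL; apply: leq_trans (hC L hL); apply/subset_leq_card/subsetP => a.
by case/setIdP => aB aL; apply/setIdP; split=> //; apply: (subsetP BC).
Qed.

Section Variance.
Variables (B : {set V}) (k : nat).
Hypotheses (hB : line_bound B k) (B0 : 0 \notin B).

Let nz a : a \in B -> a != 0.
Proof. by apply: contraTneq => ->. Qed.

Let n a t : nat := #|[set b in B | det2 a b == t]|.

Let dev a t : int := p%:R * (n a t)%:R - #|B|%:R.

Let var a : int := \sum_t dev a t ^+ 2.

Let sum_n a : (\sum_t n a t = #|B|)%N.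
Proof.
rewrite -sum1_card (partition_big (det2 a) predT) //=; apply: eq_bigr => t _.
by rewrite /n -sum1_card; apply: eq_bigl => b; rewrite inE.
Qed.

Let card_V0 : #|[set a : V | a != 0]| = (p ^ 2).-1.
Proof.
have := cardsC [set (0 : V)]; rewrite cards1 card_mx card_Fp // muln1 => <-.
by congr #|pred_of_set _|; apply/setP => a; rewrite !inE.
Qed.

Let varE a : var a = p%:R ^+ 2 * (\sum_t n a t ^ 2)%N%:R - p%:R * #|B|%:R ^+ 2.
Proof.
rewrite /var (eq_bigr (fun t => p%:R ^+ 2 * (n a t ^ 2)%N%:R - 2 * p%:R * #|B|%:R * (n a t)%:R + #|B|%:R ^+ 2)).
  rewrite big_split /= sumrB sumr_const -!mulr_sumr -!natr_sum sum_n.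
  by rewrite card_Fp // -[X in _ + X]mulr_natl; ring.
by move=> t _; rewrite /dev natrX; ring.
Qed.

Let sum_n2 : (\sum_(a : V | (a != 0)%R) \sum_t n a t ^ 2 <= #|B| * (p ^ 2).-1 + #|B| * #|B|.-1 * p.-1)%N.
Proof.
have e a : (\sum_t n a t ^ 2 = \sum_(b in B) \sum_(b' in B) (det2 a b == det2 a b'))%N.
  under eq_bigr => t _.
    rewrite -mulnn {1}/n card_sum_bool big_distrl /=.
    under eq_bigr => b _ do rewrite /n card_sum_bool big_distrr /=.
    over.
  rewrite exchange_big; apply: eq_bigr => b _ /=; rewrite exchange_big; apply: eq_bigr => b' _ /=.
  rewrite (bigD1 (det2 a b)) //= eqxx mul1n big1 ?addn0 1?eq_sym //.
  by move=> t /negbTE; rewrite eq_sym => ->.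
under eq_bigr => a _ do rewrite e.
rewrite exchange_big -mulnA -mulnDr -sum_nat_const; apply: leq_sum => b bB.
rewrite exchange_big (bigD1 b) //=; apply: leq_add.
  rewrite -card_V0 -sum1_card big_mkcond [X in (_ <= X)%N]big_mkcond; apply: leq_sum => a _.
  by rewrite inE; case: (a != 0); rewrite // leq_b1.
rewrite (_ : #|B|.-1 = #|B :\ b|); last by rewrite (cardsD1 b B) bB.
rewrite -sum_nat_const [X in (X <= _)%N](eq_bigl (mem (B :\ b))); last by move=> b'; rewrite !inE andbC.
apply: leq_sum => b'; rewrite !inE => /andP[nb _].
have w0 : b - b' != 0 by rewrite subr_eq0 eq_sym.
have cF : #|[set s : F | s != 0]| = p.-1.
  have := cardsC [set (0 : F)]; rewrite cards1 card_Fp //.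
  have -> : ~: [set (0 : F)] = [set s : F | s != 0] by apply/setP => a; rewrite !inE.
  by lia.
rewrite -cF -(card_imset [set s : F | s != 0] (f := fun s => s *: (b - b'))).
  rewrite -sum1_card big_mkcond [X in (_ <= X)%N]big_mkcond; apply: leq_sum => a _.
  case: (boolP (a != 0)) => // a0; case: eqP => // eab.
  have [d ed] : exists d, a = d *: (b - b').
    apply: (det2_eq0 w0); rewrite /det2 !mxE; move/eqP: eab; rewrite -subr_eq0 => /eqP eab.
    by apply/eqP; rewrite -oppr_eq0 -eab /det2; apply/eqP; ring.
  rewrite (_ : a \in _) //; apply/imsetP; exists d => //; rewrite inE.
  by apply: contraNneq a0 => d0; rewrite ed d0 scale0r.
by move=> s s' /eqP; rewrite -subr_eq0 -scalerBl scaler_eq0 (negbTE w0) orbF subr_eq0 => /eqP.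
Qed.

Let varZ s a : s != 0 -> var (s *: a) = var a.
Proof.
move=> s0; rewrite /var [RHS](reindex_inj (mulfI (x := s^-1) _)) /=; last by rewrite invr_eq0.
apply: eq_bigr => t _; congr ((_ * _ - _) ^+ 2); congr (_%:R); congr #|pred_of_set _|.
apply/setP => b; rewrite !inE det2Z; congr (_ && _).
by rewrite -(inj_eq (mulfI s0) (det2 a b)) mulVKf.
Qed.

Let cF : #|[set s : F | s != 0]| = p.-1.
Proof.
have := cardsC [set (0 : F)]; rewrite cards1 card_Fp //.
have -> : ~: [set (0 : F)] = [set s : F | s != 0] by apply/setP => a; rewrite !inE.
by lia.
Qed.

(* var is invariant under dilations, and a nonzero vector has at most k representations s *: a. *)
Let sum_var_dilate : p.-1%:R * \sum_(a in B) var a <= k%:R * \sum_(c : V | c != 0) var c.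
Proof.
pose U := setX B [set s : F | s != 0].
have -> : p.-1%:R * \sum_(a in B) var a = \sum_(q in U) var (q.2 *: q.1).
  rewrite -cF big_distrr /=; rewrite (eq_bigl (fun q : V * F => (q.1 \in B) && (q.2 \in [set s : F | s != 0]))).
    rewrite -(pair_big (mem B) (mem [set s : F | s != 0]) (fun a s => var (s *: a))) /=.
    apply: eq_bigr => a _; rewrite mulr_natl -sumr_const.
    by apply: eq_bigr => s; rewrite inE => s0; rewrite varZ.
  by move=> q; rewrite mem_setX.
have U0 q : q \in U -> q.2 *: q.1 != 0.
  by rewrite mem_setX inE => /andP[/nz q1 q2]; rewrite scaler_eq0 negb_or q1 q2.
rewrite (partition_big (fun q => q.2 *: q.1) (fun c : V => c != 0)) //= mulr_sumr.
apply: ler_sum => c c0; rewrite (eq_bigr (fun=> var c)) => [|q /andP[_ /eqP ->] //].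
rewrite sumr_const -[X in X <= _]mulr_natl ler_wpM2r //.
  by apply: sumr_ge0 => t _; apply: sqr_ge0.
rewrite ler_nat; apply: leq_trans (card_parallel hB c0).
rewrite -[X in (X <= _)%N]cardsE; apply: (@leq_card_in_inj _ _ _ _ fst).
  move=> [a s]; rewrite in_set => /andP[]; rewrite mem_setX /= => /andP[aB _] /eqP <-.
  by apply/setIdP; split=> //; rewrite /det2 !mxE -!mulrA [a 1 0 * _]mulrC subrr.
move=> [a s] [a' s'] h h' /= ea.
move: h; rewrite in_set => /andP[]; rewrite mem_setX /= => /andP[aB _] /eqP e.
move: h'; rewrite in_set => /andP[_ /eqP /= e'].
rewrite -{}ea in e' *; congr (_, _).
have : (s - s') *: a == 0 by rewrite scalerBl e e' subrr.
by rewrite scaler_eq0 (negbTE (nz aB)) orbF subr_eq0 => /eqP.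
Qed.

Let N t : nat := (\sum_(a in B) n a t)%N.

Lemma sum_det2 : (p * \sum_t N t ^ 2 <= #|B| ^ 4 + k * p ^ 2 * #|B| ^ 2)%N.
Proof.
case: (posnP #|B|) => [b0|b0].
  have B00 : B = set0 by apply/eqP; rewrite -cards_eq0 b0.
  by rewrite big1 ?muln0 // => t _; rewrite /N B00 big_set0.
have p1 := prime_gt1 pr.
have hV : \sum_(a in B) var a <= k%:R * p%:R ^+ 3 * #|B|%:R.
  have p1Z : 0 < (p.-1%:R : int) by rewrite ltr0n; lia.
  rewrite -(ler_pM2l p1Z); apply: le_trans sum_var_dilate _.
  have -> : \sum_(c : V | c != 0) var c =
      p%:R ^+ 2 * (\sum_(c : V | (c != 0)%R) \sum_t n c t ^ 2)%N%:R - (p ^ 2).-1%:R * (p%:R * #|B|%:R ^+ 2).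
    rewrite (eq_bigr _ (fun c _ => varE c)) sumrB -mulr_sumr -natr_sum; congr (_ - _).
    by rewrite sumr_const -[LHS]mulr_natl -card_V0 cardsE.
  have hX := sum_n2; move: (\sum_(c : V | _) _)%N hX => X hX.
  have hXZ : (X%:R : int) <= #|B|%:R * (p ^ 2).-1%:R + #|B|%:R * #|B|.-1%:R * p.-1%:R.
    by rewrite -!natrM -natrD ler_nat.
  have e1 : (p.-1%:R : int) = p%:R - 1 by lia.
  have e2 : ((p ^ 2).-1%:R : int) = p%:R ^+ 2 - 1.
    have : (0 < p ^ 2)%N by rewrite expn_gt0 prime_gt0.
    by rewrite -natrX; lia.
  have e3 : (#|B|.-1%:R : int) = #|B|%:R - 1 by lia.
  rewrite e1 e2 e3 in hXZ *.
  rewrite [leRHS](_ : _ = k%:R * ((p%:R - 1) * (p%:R ^+ 3 * #|B|%:R))); last by ring.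
  apply: ler_wpM2l; first exact: ler0n.
  have p2 : 0 <= (p%:R : int) ^+ 2 by apply: sqr_ge0.
  have h := ler_wpM2l p2 hXZ.
  apply: le_trans (lerB h (lexx _)) _.
  rewrite -subr_ge0; set r := (p%:R : int); set b := (#|B|%:R : int).
  rewrite (_ : _ - _ = r * (r - 1) * b ^+ 2); last by ring.
  by rewrite !mulr_ge0 ?sqr_ge0 // ?ler0n // /r subr_ge0 ler1n ltnW.
have hS : \sum_t (p%:R * (N t)%:R - #|B|%:R ^+ 2 : int) ^+ 2 <= #|B|%:R * \sum_(a in B) var a.
  rewrite /var exchange_big mulr_sumr; apply: ler_sum => t _ /=.
  have -> : p%:R * (N t)%:R - #|B|%:R ^+ 2 = \sum_(a in B) dev a t.
    by rewrite sumrB sumr_const -mulr_sumr /N natr_sum -[X in _ = _ - X]mulr_natl expr2.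
  exact: sum_sqr_ler.
have sN : (\sum_t N t = #|B| ^ 2)%N.
  by rewrite exchange_big -mulnn -sum_nat_const; apply: eq_bigr => a _; apply: sum_n.
move: hS; rewrite (eq_bigr (fun t => p%:R ^+ 2 * (N t ^ 2)%N%:R - 2 * p%:R * #|B|%:R ^+ 2 * (N t)%:R + #|B|%:R ^+ 4)); last first.
  by move=> t _; rewrite natrX; ring.
rewrite big_split /= sumrB sumr_const -!mulr_sumr -!natr_sum sN card_Fp // -[X in _ + X <= _]mulr_natl.
move=> hS; have pZ : 0 < (p%:R : int) by rewrite ltr0n; lia.
rewrite -(ler_nat int) -(ler_pM2l pZ) [(p * _)%:R]natrM.
have -> : (#|B| ^ 4 + k * p ^ 2 * #|B| ^ 2)%N%:R =
    #|B|%:R ^+ 4 + k%:R * p%:R ^+ 2 * #|B|%:R ^+ 2 :> int.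
  by rewrite natrD natrX (natrM _ (k * p ^ 2)%N) (natrM _ k) !natrX.
have hW := ler_wpM2l (ler0n _ #|B|) hV.
have := le_trans hS hW; rewrite [(#|B| ^ 2)%:R]natrX.
move: (_%:R : int) (_%:R : int) (_%:R : int) (_%:R : int) => c r b x h.
rewrite -subr_ge0 in h; rewrite -subr_ge0; apply: le_trans h _.
by rewrite le_eqVlt; apply/orP; left; apply/eqP; ring.
Qed.

End Variance.

End Incidence.

Lemma card_pairs (T T' : finType) (A : {set T}) (B : {set T'}) (P : T -> T' -> bool) :
  (#|[set q in setX A B | P q.1 q.2]| = \sum_(a in A) #|[set b in B | P a b]|)%N.
Proof.
rewrite (card_sum_bool _ (fun q => P q.1 q.2)).
rewrite (eq_bigl (fun q : T * T' => (q.1 \in A) && (q.2 \in B))); last by move=> q; rewrite mem_setX.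
rewrite -(pair_big (mem A) (mem B) (fun a b => P a b : nat)) /=.
by apply: eq_bigr => a _; rewrite card_sum_bool.
Qed.

Lemma rep_subset (gT : finGroupType) (S : {set gT}) (G : {group gT}) x :
  S \subset G -> x \notin G -> rep S x = 0%N.
Proof.
move=> SG; apply: contraNeq; rewrite cards_eq0 => /set0Pn[a].
rewrite in_setI mem_lcoset => /andP[/(subsetP SG) aG /(subsetP SG)].
by rewrite groupMr // groupV.
Qed.

Section Bound.
Variable p : nat.
Hypothesis pr : prime p.
Local Notation F := 'F_p.
Local Notation V := 'cV['F_p]_2.
Local Notation gT := {'GL_2['F_p]}.
Implicit Types (a b c x y : V) (t s : F) (g h : gT) (A B : {set V}) (S : {set gT}).

Lemma GLval_mul g h : GLval (g * h)%g = GLval g *m GLval h.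
Proof. by rewrite GL_ME mulmxE. Qed.

Lemma GL2_model : SL2_model (SL2_group p) (@GLval 2 F).
Proof.
split=> [||||M dM]; [exact: GLval_mul | by rewrite GL_1E | exact: val_inj | |].
  by move=> x; rewrite inE => /eqP.
have uM : M \is a GRing.unit by rewrite -[_ \is a _]/(M \in unitmx) unitmxE dM unitr1.
by exists (FinRing.unit 'M[F]_2 uM); rewrite ?inE /= ?dM.
Qed.

Let GLvalK := rhoVK GL2_model.
Let GL_fix2 := rho_fix2 GL2_model.
Let SL2_det := model_det GL2_model.

Definition returns B g : nat := #|[set y in B | GLval g *m y \in B]|.

Lemma incidences_sqr A B S : S = (S^-1)%g ->
  (incidences (setX A B) S ^ 2 <= #|A| * \sum_g rep S g * returns B g)%N.
Proof.
move=> SV; pose f (x : V) := (\sum_(g in S) (GLval g *m x \in B))%N.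
have h1 : (incidences (setX A B) S <= \sum_(x in A) f x)%N.
  have -> : (\sum_(x in A) f x = #|[set q in setX A S | GLval (q.2^-1)%g *m q.1 \in B]|)%N.
    rewrite (card_pairs A S (fun x g => GLval (g^-1)%g *m x \in B)).
    apply: eq_bigr => x _; rewrite (card_sum_bool S (fun g => GLval (g^-1)%g *m x \in B)).
    by rewrite /f {1}SV sum_invg.
  apply: (@leq_card_in_inj _ _ _ _ (fun q => (q.1.1, q.2))).
    move=> [[x y] g] /setIdP[]; rewrite !mem_setX /= => /andP[/andP[xA yB] gS] /eqP e.
    by apply/setIdP; rewrite mem_setX /= xA gS -e GLvalK.
  move=> [[x y] g] [[x' y'] g'] /setIdP[_ /eqP /= e] /setIdP[_ /eqP /= e'] [ex eg].
  by rewrite -(GLvalK g y) -(GLvalK g' y') e e' ex eg.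
apply: leq_trans (_ : (\sum_(x in A) f x) ^ 2 <= _)%N; first by rewrite leq_exp2r.
apply: leq_trans (sum_sqr_le _ _) _; rewrite leq_mul2l; apply/orP; right.
apply: leq_trans (_ : \sum_x f x ^ 2 <= _)%N; first exact: leq_sum_subset.
rewrite -sum_rep; apply: eq_leq.
transitivity (\sum_x \sum_(g in S) \sum_(h in S) (GLval g *m x \in B) * (GLval h *m x \in B))%N.
  apply: eq_bigr => x _; rewrite -mulnn /f big_distrl; apply: eq_bigr => g _ /=.
  by rewrite big_distrr.
rewrite exchange_big; apply: eq_bigr => g _; rewrite exchange_big; apply: eq_bigr => h _ /=.
rewrite /returns (card_sum_bool B (fun y => GLval (g * h^-1)%g *m y \in B)) [RHS]big_mkcond.
rewrite [RHS](reindex_inj (h := mulmx (GLval h))); last first.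
  by move=> x y e; rewrite -(GLvalK h x) e GLvalK.
apply: eq_bigr => x _; rewrite GLval_mul -mulmxA GLvalK.
by case: (GLval h *m x \in B); rewrite ?muln1 ?muln0.
Qed.

Definition indep_returns B g : nat := #|[set q in setX B B |
  [&& GLval g *m q.1 \in B, GLval g *m q.2 \in B & det2 q.1 q.2 != 0%R]]|.

Lemma returns_sqr B k g : line_bound B k -> 0 \notin B ->
  (returns B g ^ 2 <= indep_returns B g + k * returns B g)%N.
Proof.
move=> hB B0; pose M := [set y in B | GLval g *m y \in B].
rewrite -mulnn -/M -cardsX -(cardsID [set q : V * V | det2 q.1 q.2 == 0%R] (setX M M)) addnC.
apply: leq_add.
  apply/subset_leq_card/subsetP => q /setDP[]; rewrite mem_setX in_set.
  by move=> /andP[/setIdP[h1 h2] /setIdP[h3 h4]] h5; apply/setIdP; rewrite mem_setX h1 h3 h2 h4.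
apply: (@leq_card_fibres _ _ _ _ fst).
  by move=> q /setIP[]; rewrite mem_setX => /andP[].
move=> a /setIdP[aB _]; have a0 : a != 0 by apply: contraTneq aB => ->.
apply: leq_trans (card_parallel hB a0); apply: (@leq_card_in_inj _ _ _ _ snd).
  move=> [b c] /setIdP[/setIP[]]; rewrite mem_setX in_set /= => /andP[_ /setIdP[cB _]] h /eqP <-.
  by apply/setIdP.
by move=> [b c] [b' c'] /setIdP[_ /eqP /= ->] /setIdP[_ /eqP /= ->] /= ->.
Qed.

Lemma sum_indep_returns B : (\sum_(g in SL2 p) indep_returns B g <=
  \sum_(t : F) (\sum_(a in B) #|[set b in B | det2 a b == t]|) ^ 2)%N.
Proof.
pose Nt t := #|[set q in setX B B | det2 q.1 q.2 == t]|.
have -> : (\sum_(t : F) (\sum_(a in B) #|[set b in B | det2 a b == t]|) ^ 2 = \sum_t Nt t ^ 2)%N.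
  by apply: eq_bigr => t _; rewrite /Nt (card_pairs B B (fun a b => det2 a b == t)).
pose P g (q : V * V) := [&& GLval g *m q.1 \in B, GLval g *m q.2 \in B & det2 q.1 q.2 != 0].
have -> : (\sum_(g in SL2 p) indep_returns B g = \sum_(q in setX B B) #|[set g in SL2 p | P g q]|)%N.
  under eq_bigr => g _ do rewrite /indep_returns (card_sum_bool (setX B B) (P g)).
  by rewrite exchange_big; apply: eq_bigr => q _; rewrite card_sum_bool.
apply: leq_trans (_ : \sum_(q in setX B B) Nt (det2 q.1 q.2) <= _)%N.
  apply: leq_sum => q _; apply: (@leq_card_in_inj _ _ _ _ (fun g => (GLval g *m q.1, GLval g *m q.2))).
    move=> g /setIdP[gS /and3P[h1 h2 _]]; apply/setIdP; rewrite mem_setX h1 h2; split=> //.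
    by rewrite det2_mul (SL2_det gS) mul1r.
  move=> g h /setIdP[_ /and3P[_ _ d]] _ [e1 e2]; apply: (GL_fix2 _ e1 e2).
  by rewrite -subr_eq0.
rewrite (partition_big (fun q => det2 q.1 q.2) predT) //=; apply: leq_sum => t _.
rewrite (eq_bigr (fun=> Nt t)) => [|q /andP[_ /eqP -> //]].
rewrite sum_nat_const -mulnn leq_mul2r; apply/orP; right.
by apply/eq_leq/eq_card => q; rewrite [RHS]in_set.
Qed.

Lemma sum_returns B S k : S \subset SL2 p -> line_bound B k -> 0 \notin B ->
  exists2 J : nat, (\sum_g rep S g * returns B g <= 2 * k * #|S| ^ 2 + J)%N &
    (p * J ^ 2 <= 2 * energy S * (#|B| ^ 4 + k * p ^ 2 * #|B| ^ 2))%N.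
Proof.
move=> SS hB B0; pose P g := (2 * k < returns B g)%N.
exists (\sum_(g | P g) rep S g * returns B g)%N.
  rewrite (bigID P) /= addnC leq_add2r -sum_rep1 big_distrr /=.
  apply: leq_trans (_ : \sum_(g | ~~ P g) 2 * k * rep S g <= _)%N; last exact: leq_sum_subset.
  by apply: leq_sum => g; rewrite -leqNgt => h; rewrite mulnC leq_mul2r h orbT.
have -> : (\sum_(g | P g) rep S g * returns B g =
    \sum_(g | (g \in SL2 p) && P g) rep S g * returns B g)%N.
  rewrite big_mkcond [RHS]big_mkcond; apply: eq_bigr => g _.
  case: (boolP (g \in SL2 p)) => //= gS; rewrite (rep_subset SS gS) mul0n; by case: ifP.
have h1 := sum_mul_sqr_le (fun g => (g \in SL2 p) && P g) (rep S) (returns B).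
have h2 : (\sum_(g | (g \in SL2 p) && P g) rep S g ^ 2 <= energy S)%N by exact: leq_sum_subset.
have h3 : (\sum_(g | (g \in SL2 p) && P g) returns B g ^ 2 <=
    2 * \sum_(t : F) (\sum_(a in B) #|[set b in B | det2 a b == t]|) ^ 2)%N.
  apply: leq_trans (_ : 2 * \sum_(g in SL2 p) indep_returns B g <= _)%N; last first.
    by rewrite leq_mul2l sum_indep_returns.
  rewrite big_distrr big_mkcondr /=; apply: leq_sum => g _; case: ifP => // Pg.
  have := returns_sqr g hB B0; have := leq_mul (ltnW Pg) (leqnn (returns B g)).
  by rewrite -mulnn; lia.
have h4 := sum_det2 pr hB B0.
apply: leq_trans (leq_mul (leqnn p) (leq_trans h1 (leq_mul h2 h3))) _.
apply: leq_trans (_ : 2 * energy S * (p * \sum_(t : F) (\sum_(a in B) #|[set b in B | det2 a b == t]|) ^ 2) <= _)%N.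
  by lia.
by rewrite leq_mul2l h4 orbT.
Qed.

End Bound.

Lemma powR_exprn (R : realType) (x r : R) (n : nat) : (x `^ r) ^+ n = x `^ (r * n%:R).
Proof. by rewrite powRrM powR_mulrn // powR_ge0. Qed.

Lemma ler_of_sqr (R : realDomainType) (x y : R) : 0 <= x -> 0 <= y -> x ^+ 2 <= y ^+ 2 -> x <= y.
Proof. by move=> x0 y0; rewrite ler_pXn2r. Qed.

Lemma ge_lesssim (R : realType) (p : nat) (C X Y : R) :
  (2 <= p)%N -> 0 <= C -> 0 <= Y -> X <= C * Y -> lesssim C p X Y.
Proof.
move=> p2 C0 Y0 /le_trans; apply; rewrite ler_wpM2r // ler_peMr //.
have l2 : 0 < ln (2 : R) by rewrite ln_gt0 // ltr1n.
by rewrite ler_pdivlMr // mul1r ler_ln ?posrE ?ltr0n ?ler_nat //; lia.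
Qed.

Section Endgame.
Variables (R : realType) (I a J k s v : R).
Hypotheses (I0 : 0 <= I) (a0 : 0 <= a) (J_0 : 0 <= J) (v0 : 0 <= v).

Lemma incidence_bound_of_sqr u : 0 <= u -> k * s ^+ 2 <= u ^+ 2 ->
  I ^+ 2 <= a * (2 * k * s ^+ 2 + J) -> J ^+ 2 <= 8 * v ^+ 4 -> I <= 4 * (a `^ (1 / 2) * (u + v)).
Proof.
move=> u0 uE hI hJ.
have aE : (a `^ (1 / 2)) ^+ 2 = a by rewrite powR_exprn mulfVK ?pnatr_eq0 // powRr1.
have J3 : J <= 3 * v ^+ 2.
  apply: ler_of_sqr; rewrite ?mulr_ge0 ?exprn_ge0 //; apply: le_trans hJ _.
  by rewrite exprMn -exprM ler_wpM2r ?exprn_ge0 //; lra.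
have r0 := powR_ge0 a (1 / 2).
apply: ler_of_sqr => //; first by rewrite !mulr_ge0 ?addr_ge0.
apply: le_trans hI _; rewrite exprMn exprMn aE mulrCA; apply: ler_wpM2l => //.
have uv := mulr_ge0 u0 v0; have := sqr_ge0 u; have := sqr_ge0 v.
rewrite sqrrD -mulrA; lra.
Qed.

End Endgame.

Lemma two_neq0 (p : nat) : prime p -> (2 < p)%N -> (2 : 'F_p) != 0.
Proof. by move=> pr p2; rewrite -(dvdn_pcharf (pchar_Fp pr)) (gtnNdvd _ p2). Qed.

Lemma energy_bound (R : realType) (gamma : R) : 0 < gamma ->
  exists2 eps : R, 0 < eps <= gamma & exists p0 : nat,
  forall (p : nat) (S : {set {'GL_2['F_p]}}), prime p -> (p0 <= p)%N -> S \subset SL2 p ->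
    p%:R `^ gamma < #|S|%:R :> R ->
    #|S|%:R < p%:R `^ (3 - 2 * gamma) :> R ->
    (forall (H : {group {'GL_2['F_p]}}) (g : {'GL_2['F_p]}),
       H \proper SL2 p -> g \in SL2 p ->
       #|S :&: (g *: H)%g|%:R < p%:R `^ (- (gamma / 2)) * #|S|%:R :> R) ->
    (2 < p)%N /\ p%:R `^ eps * (energy S)%:R <= 2 * #|S|%:R ^+ 3 :> R.
Proof.
move=> g0; have g2 : gamma / 4 <= gamma / 2 by lra.
have g1 : gamma / 4 <= gamma by lra.
have g3 : gamma / 4 + (3 - 2 * gamma) <= 3 by lra.
have [e flat] := flattening.
have e1 : 0 < (e.+1%:R : R) by rewrite ltr0n.
pose eps := gamma / (4 * e.+1%:R).
have eps0 : 0 < eps by rewrite divr_gt0 // mulr_gt0.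
have epse : eps * e%:R <= gamma / 4.
  rewrite /eps mulrAC ler_pdivrMr ?mulr_gt0 // mulrA mulfVK ?pnatr_eq0 //.
  by rewrite ler_wpM2l ?(ltW g0) // ler_nat.
exists eps.
  rewrite eps0 /eps ler_pdivrMr ?mulr_gt0 // ler_peMr ?(ltW g0) //.
  by rewrite -natrM ler1n.
exists (maxn 3 (Num.truncn ((2 : R) `^ eps^-1)).+1) => p S pr; rewrite geq_max => /andP[p3 hp] SS hs1 hs2 hH.
split=> //; set P : R := p%:R in hs1 hs2 hH *.
have P1 : 1 <= P by rewrite ler1n prime_gt0.
have P0 : 0 < P by apply: lt_le_trans P1.
have q2 : 2 <= P `^ eps.
  have -> : 2 = (2 `^ eps^-1) `^ eps :> R by rewrite -powRrM mulVf ?gt_eqF // powRr1.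
  apply: ge0_ler_powR; rewrite ?nnegrE ?powR_ge0 ?(ltW eps0) ?(ltW P0) //.
  have /andP[_ /ltW h] := truncn_itv (powR_ge0 (2 : R) eps^-1).
  by apply: le_trans h _; rewrite ler_nat.
have /andP[hK1 hK2] := truncn_itv (powR_ge0 P eps).
set K := Num.truncn _ in hK1 hK2.
have K2 : (1 < K)%N.
  by rewrite -ltnS -(ltr_nat R); apply: le_lt_trans hK2.
have s0 : 0 < (#|S|%:R : R) by apply: le_lt_trans hs1; apply: powR_ge0.
have S0 : (0 < #|S|)%N by rewrite -(ltr_nat R).
have Ke : (K ^ e)%N%:R <= P `^ (gamma / 4).
  apply: le_trans (ler_powR P1 epse); rewrite powRrM powR_mulrn ?powR_ge0 // natrX.
  by rewrite lerXn2r ?nnegrE ?powR_ge0.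
have hKE : (K * energy S <= #|S| ^ 3)%N.
  case: (leqP (K * energy S) (#|S| ^ 3)) => // /ltnW h; exfalso.
  case: (flat _ _ _ _ S K (GL2_model p) (two_neq0 pr p3) K2 SS S0 h) => [[H [g [Hp gS hS]]]|hS|hS].
  - have := hH H g Hp gS; rewrite ltNge => /negP; apply.
    rewrite powRN mulrC ler_pdivrMr ?powR_gt0 //.
    apply: le_trans (_ : (K ^ e * #|S :&: (g *: H)%g|)%N%:R <= _); first by rewrite ler_nat.
    rewrite natrM mulrC ler_wpM2l //; apply: le_trans Ke _; exact: ler_powR.
  - move: hs1; rewrite ltNge => /negP; apply.
    apply: le_trans (_ : (K ^ e)%N%:R <= _); first by rewrite ler_nat.
    by apply: le_trans Ke _; exact: ler_powR.
  rewrite card_Fp // in hS.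
  have : P `^ 3 <= P `^ (gamma / 4) * #|S|%:R.
    rewrite powR_mulrn ?(ltW P0) // -natrX; apply: le_trans (_ : (K ^ e * #|S|)%N%:R <= _).
      by rewrite ler_nat.
    by rewrite natrM ler_wpM2r.
  rewrite leNgt => /negP; apply.
  apply: lt_le_trans (_ : P `^ (gamma / 4) * P `^ (3 - 2 * gamma) <= _).
    by rewrite ltr_pM2l ?powR_gt0.
  rewrite -powRD; last by rewrite (gt_eqF P0) implybT.
  exact: ler_powR.
have hq : P `^ eps <= 2 * K%:R.
  by apply: le_trans (ltW hK2) _; rewrite -natrM ler_nat mul2n -addnn -addn1 leq_add2l ltnW.
apply: le_trans (ler_wpM2r (ler0n _ _) hq) _.
by rewrite -mulrA -natrM -natrX ler_wpM2l // ler_nat.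
Qed.

Section Exponents.
Variables (R : realType) (P q k b s J E eps gamma : R).
Hypotheses (P1 : 1 <= P) (k0 : 0 <= k) (b0 : 0 <= b) (s0 : 0 <= s).
Hypotheses (qE : q = P `^ eps) (hE : q * E <= 2 * s ^+ 3).

Let P0 : 0 < P. Proof. exact: lt_le_trans P1. Qed.
Let q0 : 0 < q. Proof. by rewrite qE powR_gt0. Qed.
Let PE r t : P `^ (r + t) = P `^ r * P `^ t.
Proof. by rewrite powRD // (gt_eqF P0) implybT. Qed.

Lemma small_main_term : P * J ^+ 2 <= 4 * E * (k * P ^+ 2 * b ^+ 2) ->
  J ^+ 2 <= 8 * (k `^ (1 / 4) * P `^ ((1 - eps) / 4) * b `^ (1 / 2) * s `^ (3 / 4)) ^+ 4.
Proof.
move=> hJ; rewrite !exprMn !powR_exprn.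
have -> : (1 / 4 * 4 : R) = 1 by field.
have -> : ((1 - eps) / 4 * 4 : R) = 1 - eps by field.
have -> : (1 / 2 * 4 : R) = 2%:R by field.
have -> : (3 / 4 * 4 : R) = 3%:R by field.
rewrite powRr1 // !powR_mulrn // PE powRr1 ?(ltW P0) // powRN -qE.
have hk : 0 <= k * P * b ^+ 2 by rewrite !mulr_ge0 ?exprn_ge0 // ltW.
have h := ler_wpM2l hk hE.
have Pq : 0 < P * q by rewrite mulr_gt0.
rewrite -(ler_pM2l Pq); have h2 := ler_wpM2l (ltW q0) hJ.
have -> : P * q * (8 * (k * (P * q^-1) * b ^+ 2 * s ^+ 3)) = 4 * P * (k * P * b ^+ 2 * (2 * s ^+ 3)).
  by field; rewrite gt_eqF.
have h3 : 0 <= 4 * P by rewrite mulr_ge0 // ltW.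
apply: le_trans (ler_wpM2l h3 h); move: h2; apply: etrans; congr (_ <= _); ring.
Qed.

Let large_pow4 w : w = b * s `^ (3 / 4) / P `^ ((1 + eps) / 4) ->
  w ^+ 4 = b ^+ 4 * s ^+ 3 / (P * q).
Proof.
move=> ->; rewrite !exprMn exprVn !powR_exprn.
have -> : ((1 + eps) / 4 * 4 : R) = 1 + eps by field.
have -> : (3 / 4 * 4 : R) = 3%:R by field.
by rewrite powR_mulrn // PE powRr1 ?(ltW P0) // -qE.
Qed.

Lemma large_main_term w : w = b * s `^ (3 / 4) / P `^ ((1 + eps) / 4) ->
  P * J ^+ 2 <= 4 * E * b ^+ 4 -> J ^+ 2 <= 8 * w ^+ 4.
Proof.
move=> wE hJ; rewrite (large_pow4 wE).
have Pq : 0 < P * q by rewrite mulr_gt0.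
have h := ler_wpM2l (ltW q0) hJ.
have h4 : 0 <= 4 * b ^+ 4 by rewrite mulr_ge0 ?exprn_ge0.
have h2 := ler_wpM2l h4 hE.
rewrite mulrA ler_pdivlMr // mulrC -(mulrA P) mulrCA; apply: le_trans h _.
move: h2; apply: etrans; congr (_ <= _); ring.
Qed.

Lemma large_diagonal_term w : w = b * s `^ (3 / 4) / P `^ ((1 + eps) / 4) ->
  0 <= gamma -> eps <= gamma -> s <= P `^ (3 - 2 * gamma) -> k * P ^+ 2 <= b ^+ 2 -> k * s ^+ 2 <= w ^+ 2.
Proof.
move=> wE g0 epsg hs hk; have Pq : 0 < P * q by rewrite mulr_gt0.
apply: ler_of_sqr; [by rewrite mulr_ge0 ?sqr_ge0 | exact: sqr_ge0 |].
rewrite -exprM (large_pow4 wE) ler_pdivlMr //.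
have hsP : s * (P * q) <= P ^+ 4.
  apply: le_trans (ler_wpM2r (ltW Pq) hs) _.
  rewrite -[X in X * q]powRr1 ?(ltW P0) // qE -PE -PE -powR_mulrn ?(ltW P0) //.
  by apply: ler_powR => //; lra.
have hkP : k ^+ 2 * P ^+ 4 <= b ^+ 4.
  have h0 : 0 <= k * P ^+ 2 by rewrite mulr_ge0 ?sqr_ge0.
  by have := ler_pM h0 h0 hk hk; rewrite -!expr2 exprMn -!exprM.
have h1 := ler_wpM2l (exprn_ge0 3 s0) (le_trans (ler_wpM2l (sqr_ge0 k) hsP) hkP).
move: h1; apply: etrans; congr (_ <= _); ring.
Qed.

End Exponents.

Theorem theorem2p10 (R : realType) (gamma : R) :
  0 < gamma < 1 ->
  exists2 eps : R, 0 < eps &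
  exists2 C : R, 0 < C &
  exists p0 : nat,
  forall (p : nat), prime p -> (p0 <= p)%N ->
  forall (A B : {set 'cV['F_p]_2}) (S : {set {'GL_2['F_p]}}) (k : nat),
    (0, 0) \notin setX A B ->
    S \subset SL2 p ->
    S = (S^-1)%g ->
    p%:R `^ gamma < #|S|%:R :> R ->
    #|S|%:R < p%:R `^ (3 - 2 * gamma) :> R ->
    (forall (H : {group {'GL_2['F_p]}}) (g : {'GL_2['F_p]}),
       H \proper SL2 p -> g \in SL2 p ->
       #|S :&: (g *: H)%g|%:R < p%:R `^ (- (gamma / 2)) * #|S|%:R :> R) ->
    line_bound B k ->
    (#|B|%:R < k%:R `^ (1 / 2) * p%:R :> R ->
       lesssim C p (incidences (setX A B) S)%:R
         (k%:R `^ (1 / 2) * #|A|%:R `^ (1 / 2) * #|S|%:R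
          + k%:R `^ (1 / 4) * p%:R `^ ((1 - eps) / 4)
            * #|A|%:R `^ (1 / 2) * #|B|%:R `^ (1 / 2) * #|S|%:R `^ (3 / 4)))
    /\
    (k%:R `^ (1 / 2) * p%:R <= #|B|%:R :> R ->
       lesssim C p (incidences (setX A B) S)%:R
         (#|A|%:R `^ (1 / 2) * #|B|%:R * #|S|%:R `^ (3 / 4)
          / p%:R `^ ((1 + eps) / 4))).
Proof.
move=> /andP[gamma0 _]; have [eps /andP[eps0 epsg] [p0 hp0]] := energy_bound gamma0.
exists eps => //; exists 8; first by [].
exists p0 => p pr pp0 A B S k AB0 SS SV hs1 hs2 hH hB.
have [p2 hE] := hp0 p S pr pp0 SS hs1 hs2 hH.
pose B' := B :\ 0.
have [J hJ1 hJ2] := sum_returns pr SS (line_boundW (subD1set B 0) hB) (negbT (setD11 0 B)).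
have hI : (incidences (setX A B) S)%:R ^+ 2 <= #|A|%:R * (2 * k%:R * #|S|%:R ^+ 2 + J%:R) :> R.
  have IE : incidences (setX A B) S = incidences (setX A B') S.
    congr #|pred_of_set _|; apply/setP => -[[x y] g]; rewrite !inE /=.
    case: (eqVneq y 0) => //= ->; rewrite mulmx0 andbF /=; apply/negP.
    move=> /andP[/andP[/andP[xA yB] _] /eqP x0]; case/negP: AB0.
    by rewrite mem_setX /= yB x0 xA.
  rewrite IE -natrX [leRHS](_ : _ = (#|A| * (2 * k * #|S| ^ 2 + J))%N%:R); last first.
    by rewrite natrM natrD (natrM _ (2 * k)%N) (natrM _ 2) natrX.
  rewrite ler_nat.
  by apply: leq_trans (incidences_sqr A B' SV) _; rewrite leq_mul2l hJ1 orbT.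
have hJ : p%:R * J%:R ^+ 2 <= 2 * (energy S)%:R * (#|B|%:R ^+ 4 + k%:R * p%:R ^+ 2 * #|B|%:R ^+ 2) :> R.
  have BB : (#|B'| <= #|B|)%N by apply/subset_leq_card/subD1set.
  have h4 : (#|B'| ^ 4 + k * p ^ 2 * #|B'| ^ 2 <= #|B| ^ 4 + k * p ^ 2 * #|B| ^ 2)%N.
    by apply: leq_add; rewrite ?leq_mul2l leq_exp2r // BB ?orbT.
  have := leq_trans hJ2 (leq_mul (leqnn _) h4); rewrite -(ler_nat R).
  rewrite [(p * _)%:R]natrM natrX (natrM _ (2 * energy S)%N) (natrM _ 2) natrD natrX.
  by rewrite (natrM _ (k * p ^ 2)%N) (natrM _ k) !natrX.
have E0 : 0 <= (energy S)%:R :> R := ler0n _ _.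
have PR1 : 1 <= (p%:R : R) by rewrite ler1n prime_gt0.
have c0 : (0 : R) <= 8 by [].
have kE : (k%:R `^ (1 / 2) : R) ^+ 2 = k%:R by rewrite powR_exprn mulfVK ?pnatr_eq0 // powRr1.
have r0 (x y : R) : 0 <= x `^ y by apply: powR_ge0.
have B0 : 0 <= #|B|%:R :> R := ler0n _ _.
have kP0 : 0 <= k%:R `^ (1 / 2) * p%:R :> R by rewrite mulr_ge0.
have kP2 : (k%:R `^ (1 / 2) * p%:R) ^+ 2 = k%:R * p%:R ^+ 2 :> R by rewrite exprMn kE.
split=> hk; apply: ge_lesssim; rewrite ?(ltnW p2) //.
- by rewrite addr_ge0 ?mulr_ge0.
- have hB2 : #|B|%:R ^+ 2 <= k%:R * p%:R ^+ 2 :> R by rewrite -kP2 lerXn2r ?nnegrE // ltW.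
  have hJ4 : p%:R * J%:R ^+ 2 <= 4 * (energy S)%:R * (k%:R * p%:R ^+ 2 * #|B|%:R ^+ 2) :> R.
    apply: le_trans hJ _; have := ler_wpM2r (sqr_ge0 (#|B|%:R : R)) hB2.
    rewrite -exprD => h; have := ler_wpM2l E0 h; lra.
  have hJv := small_main_term PR1 (ler0n _ _) (ler0n _ _) (ler0n _ _) erefl hE hJ4.
  have hu : k%:R * #|S|%:R ^+ 2 <= (k%:R `^ (1 / 2) * #|S|%:R) ^+ 2 :> R by rewrite exprMn kE.
  apply: le_trans (incidence_bound_of_sqr (ler0n _ _) (ler0n _ _) (ler0n _ _) _ _ hu hI hJv) _.
  + by rewrite !mulr_ge0.
  + by rewrite mulr_ge0.
  rewrite [leLHS](_ : _ = 4 * (k%:R `^ (1 / 2) * #|A|%:R `^ (1 / 2) * #|S|%:R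
      + k%:R `^ (1 / 4) * p%:R `^ ((1 - eps) / 4)
        * #|A|%:R `^ (1 / 2) * #|B|%:R `^ (1 / 2) * #|S|%:R `^ (3 / 4))); last by ring.
  by rewrite ler_wpM2r ?ler_nat // addr_ge0 ?mulr_ge0.
- by rewrite !mulr_ge0 ?invr_ge0.
have hB2 : k%:R * p%:R ^+ 2 <= #|B|%:R ^+ 2 :> R by rewrite -kP2 lerXn2r ?nnegrE.
have hJ4 : p%:R * J%:R ^+ 2 <= 4 * (energy S)%:R * #|B|%:R ^+ 4 :> R.
  apply: le_trans hJ _; have := ler_wpM2r (sqr_ge0 (#|B|%:R : R)) hB2.
  rewrite -exprD => h; have := ler_wpM2l E0 h; lra.
set w : R := #|B|%:R * #|S|%:R `^ (3 / 4) / p%:R `^ ((1 + eps) / 4).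
have w0 : 0 <= w by rewrite !mulr_ge0 ?invr_ge0.
have hJw := large_main_term PR1 (ler0n _ _) (ler0n _ _) erefl hE (erefl w) hJ4.
have hu := large_diagonal_term PR1 (ler0n _ _) (ler0n _ _) erefl (erefl w) (ltW gamma0) epsg (ltW hs2) hB2.
apply: le_trans (incidence_bound_of_sqr (ler0n _ _) (ler0n _ _) (ler0n _ _) w0 w0 hu hI hJw) _.
by rewrite /w le_eqVlt; apply/orP; left; apply/eqP; ring.
Qed.
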